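(* Let $n\ge 3$, $\alpha<1$, $p\in(1,\infty]$ and let $q\in[1,\infty)$ be its conjugate exponent ($1/p+1/q=1$). Let $\phi\in L^{p}(\mathbb{S}^{n-1},\mathbb{R})$ and $u=P_\alpha[\phi]$ in $\mathbb{B}^n$. Then for every $x\in\mathbb{B}^n$, $$|\nabla u(x)|\le \frac{(n-\alpha)C_{n,\alpha}}{(1-|x|^2)^{\frac{n(q-1)+1}{q}}}\Big(\sup_{l\in\mathbb{S}^{n-1}} I(\alpha,q,x,l)+J(\alpha,q,x)\Big)^{1/q}\|\phi\|_{L^p(\mathbb{S}^{n-1},\mathbb{R})},$$ where $$I(\alpha,q,x,l)=\int_{\mathbb{S}^{n-1}}|\eta-x|^{(n-\alpha)q-2n+2}|\langle \eta,l\rangle|^q\,d\sigma(\eta),$$ $$J(\alpha,q,x)=q|x|\frac{|2-\alpha-n|}{n-\alpha}\Big(1+\frac{|2-\alpha-n|}{n-\alpha}|x|\Big)^{q-1}{}_2F_1\Big(n-1-\tfrac{q(n-\alpha)}{2},\ \tfrac{n-q(n-\alpha)}{2};\ \tfrac n2;\ |x|^2\Big).$$ Moreover, if $x=0$ or $\alpha=2-n$, the coefficient of $\|\phi\|_{L^p}$ on the right-hand side equals the optimal constant $\mathbf{C}_{\alpha,q}(x)$, i.e. the inequality is sharp.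
   Context: Throughout, $n\ge3$, $\mathbb{B}^n$ is the open unit ball of $\mathbb{R}^n$, $\mathbb{S}^{n-1}$ its boundary sphere, and $\sigma$ the normalized surface measure on $\mathbb{S}^{n-1}$ ($\sigma(\mathbb{S}^{n-1})=1$); $L^p$ norms on $\mathbb{S}^{n-1}$ are with respect to $\sigma$. For $\alpha<1$, the Poisson–Szegő kernel is $P_\alpha(x,\zeta)=C_{n,\alpha}\frac{(1-|x|^2)^{1-\alpha}}{|x-\zeta|^{n-\alpha}}$ ($x\in\mathbb{B}^n,\zeta\in\mathbb{S}^{n-1}$) with $C_{n,\alpha}=\frac{\Gamma(\frac{n-\alpha}{2})\Gamma(1-\frac\alpha2)}{\Gamma(\frac n2)\Gamma(1-\alpha)}$, and for $\phi\in L^p(\mathbb{S}^{n-1},\mathbb{R}^m)$, $p\in[1,\infty]$, $P_\alpha[\phi](x)=\int_{\mathbb{S}^{n-1}}P_\alpha(x,\zeta)\phi(\zeta)\,d\sigma(\zeta)$. For $p\in[1,\infty]$ with conjugate exponent $q$, $x\in\mathbb{B}^n$ and $l\in\mathbb{S}^{n-1}$, $\mathbf{C}_{\alpha,q}(x)$ (resp. $\mathbf{C}_{\alpha,q}(x;l)$) denotes the smallest constant such that $|\nabla u(x)|\le \mathbf{C}_{\alpha,q}(x)\|\phi\|_{L^p(\mathbb{S}^{n-1},\mathbb{R})}$ (resp. $|\langle\nabla u(x),l\rangle|\le \mathbf{C}_{\alpha,q}(x;l)\|\phi\|_{L^p(\mathbb{S}^{n-1},\mathbb{R})}$) for all $\phi\in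 L^p(\mathbb{S}^{n-1},\mathbb{R})$, where $u=P_\alpha[\phi]$. ${}_2F_1$ denotes the Gauss hypergeometric series $\sum_{k\ge0}\frac{(a)_k(b)_k}{(c)_k}\frac{s^k}{k!}$ with $(a)_k$ the Pochhammer symbol. *)

(* Defs.v *)
From HB Require Import structures.
From mathcomp Require Import all_boot all_order all_algebra.
From mathcomp Require Import all_classical all_reals all_analysis.
Set Implicit Arguments. Unset Strict Implicit. Unset Printing Implicit Defensive.
Import Order.TTheory GRing.Theory Num.Theory numFieldNormedType.Exports.
Local Open Scope classical_set_scope.
Local Open Scope ring_scope.

Section Defs.
Variables (R : realType) (n : nat).

Definition dotv (x y : 'rV[R]_n) : R := \sum_(i < n) x ord0 i * y ord0 i.
Definition enorm (x : 'rV[R]_n) : R := Num.sqrt (dotv x x).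
Definition unit_sphere : set 'rV[R]_n := [set z | enorm z = 1].
Definition unit_ball : set 'rV[R]_n := [set z | enorm z < 1].

Definition borelRn := g_sigma_algebraType (@open 'rV[R]_n).

(* normalized surface measure on S^{n-1}: the rotation-invariant Borel
   probability measure concentrated on the unit sphere (unique such). *)
Definition is_normalized_sphere_measure
    (mu : {measure set borelRn -> \bar R}) : Prop :=
  mu [set: borelRn] = 1%E /\
  mu (~` (unit_sphere : set borelRn)) = 0%E /\
  forall Q : 'M[R]_n, Q *m Q^T = 1%:M ->
    forall A : set borelRn, measurable A ->
      mu ((fun x : borelRn => (x *m Q : borelRn)) @^-1` A) = mu A.

Definition Gamma (s : R) : R :=
  Rintegral lebesgue_measure `]0, +oo[ (fun t => t `^ (s - 1) * expR (- t)).

Definition Cna (a : R) : R :=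
  Gamma ((n%:R - a) / 2) * Gamma (1 - a / 2) / (Gamma (n%:R / 2) * Gamma (1 - a)).

Definition Pker (a : R) (x zeta : 'rV[R]_n) : R :=
  Cna a * (1 - enorm x ^+ 2) `^ (1 - a) / enorm (x - zeta) `^ (n%:R - a).

Definition Pint (mu : {measure set borelRn -> \bar R}) (a : R)
    (phi : borelRn -> R) (x : 'rV[R]_n) : R :=
  Rintegral mu [set: borelRn] (fun zeta : borelRn => Pker a x zeta * phi zeta).

Definition grad (u : 'rV[R]_n -> R) (x : 'rV[R]_n) : 'rV[R]_n :=
  \row_(i < n) ('D_(delta_mx ord0 i) u x).

Definition in_Lp (mu : {measure set borelRn -> \bar R}) (p : \bar R)
    (phi : borelRn -> R) : Prop :=
  measurable_fun [set: borelRn] phi /\ (Lnorm mu p (EFin \o phi) < +oo)%E.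

Definition Lpnorm (mu : {measure set borelRn -> \bar R}) (p : \bar R)
    (phi : borelRn -> R) : R := fine (Lnorm mu p (EFin \o phi)).

Definition poch (a : R) (k : nat) : R := \prod_(i < k) (a + i%:R).
Definition hyp2F1 (a b c s : R) : R :=
  limn (series (fun k : nat => poch a k * poch b k / poch c k * s ^+ k / (k`!)%:R)).

Definition Ifun (mu : {measure set borelRn -> \bar R}) (a q : R)
    (x l : 'rV[R]_n) : R :=
  Rintegral mu [set: borelRn] (fun eta : borelRn =>
    enorm (eta - x) `^ ((n%:R - a) * q - 2 * n%:R + 2) * `|dotv eta l| `^ q).

Definition Jfun (a q : R) (x : 'rV[R]_n) : R :=
  q * enorm x * (`|2 - a - n%:R| / (n%:R - a)) *
  (1 + `|2 - a - n%:R| / (n%:R - a) * enorm x) `^ (q - 1) *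
  hyp2F1 (n%:R - 1 - q * (n%:R - a) / 2) ((n%:R - q * (n%:R - a)) / 2)
         (n%:R / 2) (enorm x ^+ 2).

Definition Kcoef (mu : {measure set borelRn -> \bar R}) (a q : R)
    (x : 'rV[R]_n) : R :=
  (n%:R - a) * Cna a / (1 - enorm x ^+ 2) `^ ((n%:R * (q - 1) + 1) / q) *
  (sup [set Ifun mu a q x l | l in unit_sphere] + Jfun a q x) `^ (q^-1).

End Defs.

(* Main.v *)
Require Import Defs.
From HB Require Import structures.
From mathcomp Require Import all_boot all_order all_algebra.
From mathcomp Require Import all_classical all_reals all_analysis.
From mathcomp Require Import measurable_realfun ess_sup_inf ring lra.
Import Order.TTheory GRing.Theory Num.Theory numFieldNormedType.Exports.
Local Open Scope classical_set_scope.
Local Open Scope ring_scope.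
Set Implicit Arguments. Unset Strict Implicit. Unset Printing Implicit Defensive.

(* By duality, the best constant for [<grad u (x), l>] is the [L^q] norm over the
   sphere of [<grad_x P_a (x, .), l>].  The Moebius involution exchanging [x] and
   [0] turns this kernel into [|y - x|^(n - a) (y + kappa x)] up to a constant, with
   [kappa = (2 - a - n) / (n - a)]; dropping the term [kappa x] costs at most [J],
   and nothing if [x = 0] or [kappa = 0].

   Since the surface measure is only given by its invariance under rotations,
   everything is derived from the divergence theorem
     int (<e, grad g> - <e, y> <y, grad g>) = (n - 1) int <e, y> g,
   the infinitesimal form of this invariance.  It shows that a function which is
   homogeneous of degree [1 - n] on the light cone has an integral invariant under
   Lorentz boosts, which is the Moebius change of variables; and it yields the
   hypergeometric equation for [r -> int |r e - y|^(2 c)]. *)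

(** The exponent [(n - a) * q - 2 * n + 2] in [Ifun] is forced by homogeneity. The [q]-th power of
    the kernel is a power of the form [|x - y|^2] times the [q]-th power of another linear form on
    the cone, of total degree [- (n - a) * q / 2], whereas boost invariance needs [1 - n]. The
    missing degree is carried by a power of the form that equals 1 on the sphere. The boost turns
    [|x - y|^2] into a constant and 1 into a multiple of [|x + y|^2], so this invisible factor
    becomes the weight. The dual norm in each direction [l] is therefore exact, and the only loss is
    [(b + d)^q <= b^q + q d (b + d)^(q - 1)] with [b = |<y, l>| <= 1] and [d = |kappa| |x|]; it
    produces the prefactor of [J]. Two obstacles shape the rest. The base [|L|] of [|L|^q] vanishes
    somewhere, so invariance is proved for a smooth approximation of the same degree and passed to
    the limit. The hypergeometric equation is singular at [r = 0], so uniqueness comes from a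
    Wronskian weighted by [r^(n - 1)]. *)

Section dot_product.
Context {R : realType} {n : nat}.
Implicit Types (x y b : 'rV[R]_n) (i j : 'I_n).

Definition evec i : 'rV[R]_n := delta_mx ord0 i.

Lemma rvDE x y i : (x + y) ord0 i = x ord0 i + y ord0 i.
Proof. by rewrite mxE. Qed.

Lemma rvZE c x i : (c *: x) ord0 i = c * x ord0 i.
Proof. by rewrite mxE. Qed.

Lemma rvNE x i : (- x) ord0 i = - x ord0 i.
Proof. by rewrite mxE. Qed.

Lemma dotvC x y : dotv x y = dotv y x.
Proof. by apply: eq_bigr => i _; rewrite mulrC. Qed.

Lemma dotvDr b x y : dotv b (x + y) = dotv b x + dotv b y.
Proof. by rewrite /dotv -big_split; apply: eq_bigr => i _; rewrite mxE mulrDr. Qed.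

Lemma dotvZr b c x : dotv b (c *: x) = c * dotv b x.
Proof. by rewrite /dotv mulr_sumr; apply: eq_bigr => i _; rewrite mxE mulrCA. Qed.

Lemma dotvNr b x : dotv b (- x) = - dotv b x.
Proof. by rewrite -scaleN1r dotvZr mulN1r. Qed.

Lemma dotvBr b x y : dotv b (x - y) = dotv b x - dotv b y.
Proof. by rewrite dotvDr dotvNr. Qed.

Lemma dotvDl b x y : dotv (x + y) b = dotv x b + dotv y b.
Proof. by rewrite dotvC dotvDr !(dotvC b). Qed.

Lemma dotvZl b c x : dotv (c *: x) b = c * dotv x b.
Proof. by rewrite dotvC dotvZr (dotvC b). Qed.

Lemma dotvNl b x : dotv (- x) b = - dotv x b.
Proof. by rewrite dotvC dotvNr (dotvC b). Qed.

Lemma dotvBl b x y : dotv (x - y) b = dotv x b - dotv y b.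
Proof. by rewrite dotvDl dotvNl. Qed.

Lemma dotv0 b : dotv b 0 = 0.
Proof. by rewrite -(scale0r 0) dotvZr mul0r. Qed.

Lemma dotv_evec b i : dotv b (evec i) = b ord0 i.
Proof.
rewrite /dotv (bigD1 i)//= big1 ?addr0; last first.
  by move=> k ki; rewrite /evec mxE (negbTE ki) andbF mulr0.
by rewrite /evec mxE !eqxx mulr1.
Qed.

Lemma dotv_ge0 x : 0 <= dotv x x.
Proof. by apply: sumr_ge0 => i _; rewrite -expr2 sqr_ge0. Qed.

Lemma enorm_ge0 x : 0 <= enorm x.
Proof. exact: sqrtr_ge0. Qed.

Lemma enorm_sqr x : enorm x ^+ 2 = dotv x x.
Proof. by rewrite sqr_sqrtr // dotv_ge0. Qed.

Lemma sphere_dotv x : unit_sphere x -> dotv x x = 1.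
Proof. by rewrite /unit_sphere /= -enorm_sqr => ->; rewrite expr1n. Qed.

Lemma sphereP x : dotv x x = 1 -> unit_sphere x.
Proof. by rewrite /unit_sphere /= /enorm => ->; rewrite sqrtr1. Qed.

Lemma sphere_evec i : unit_sphere (evec i).
Proof. by apply: sphereP; rewrite dotv_evec mxE !eqxx. Qed.

Lemma dotv_cauchy x y : `|dotv x y| <= enorm x * enorm y.
Proof.
have H : dotv x y ^+ 2 <= dotv x x * dotv y y.
  have [x0|xn0] := eqVneq (dotv x x) 0.
    have {}x0 : x = 0.
      apply/rowP => i; rewrite mxE; apply/eqP; rewrite -sqrf_eq0; apply/eqP/le_anti.
      rewrite sqr_ge0 andbT -x0 /dotv (bigD1 i)//= expr2 lerDl sumr_ge0// => j _.
      by rewrite -expr2 sqr_ge0.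
    by rewrite x0 (dotvC 0) dotv0 expr0n/= dotv0 mul0r.
  have xx : 0 < dotv x x by rewrite lt_neqAle eq_sym xn0 dotv_ge0.
  have := dotv_ge0 (dotv x x *: y - dotv x y *: x).
  rewrite dotvBr !dotvZr !dotvBl !dotvZl (dotvC y x) => h.
  have h2 : 0 <= dotv x x * (dotv x x * dotv y y - dotv x y ^+ 2).
    by move: h; congr (_ <= _); ring.
  by move: h2; rewrite pmulr_rge0// subr_ge0.
rewrite -(ler_pXn2r (_ : 0 < 2)%N)// ?nnegrE ?mulr_ge0 ?enorm_ge0//.
by rewrite real_normK ?num_real// exprMn !enorm_sqr.
Qed.

Lemma sphere_dotv_le x y : unit_sphere y -> `|dotv x y| <= enorm x.
Proof. by move=> hy; rewrite (le_trans (dotv_cauchy x y))// hy mulr1. Qed.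

Lemma sphere_coord_le y i : unit_sphere y -> `|y ord0 i| <= 1.
Proof.
move=> hy; rewrite -dotv_evec dotvC (le_trans (sphere_dotv_le _ hy))//.
by rewrite (sphere_evec i).
Qed.

End dot_product.

(** * Rotations in coordinate planes *)

Section rotations.
Context {R : realType} {n : nat}.
Implicit Types (x y b : 'rV[R]_n) (i j : 'I_n).

(** Rotation by the angle [t] in the plane of [i] and [j], as the identity plus a correction, so
    that inner products with it are explicit in [cos t] and [sin t]. It is a rotation only for
    [i != j]. *)
Definition prot i j (t : R) y : 'rV[R]_n :=
  y + (cos t - 1) *: (y ord0 i *: evec i + y ord0 j *: evec j)
    + sin t *: (y ord0 i *: evec j - y ord0 j *: evec i).

Definition rotmx i j (t : R) : 'M[R]_n :=
  1%:M + (cos t - 1) *: (delta_mx i i + delta_mx j j)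
    + sin t *: (delta_mx i j - delta_mx j i).

Lemma rotmxE i j t y : y *m rotmx i j t = prot i j t y.
Proof.
have d a c : y *m delta_mx a c = y ord0 a *: evec c.
  rewrite -(mul_delta_mx (0 : 'I_1)) mulmxA -colE; apply/rowP => k.
  by rewrite !mxE big_ord1 !mxE.
by rewrite /rotmx !mulmxDr mulmx1 -!scalemxAr !mulmxDr mulmxN !d.
Qed.

Lemma dotv_rot i j t b y : dotv b (prot i j t y) =
  dotv b y + (cos t - 1) * (b ord0 i * y ord0 i + b ord0 j * y ord0 j)
    + sin t * (b ord0 j * y ord0 i - b ord0 i * y ord0 j).
Proof.
by rewrite /prot !dotvDr !dotvZr !dotvDr !dotvNr !dotvZr !dotv_evec; ring.
Qed.

Lemma rot_i i j t y : i != j ->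
  prot i j t y ord0 i = cos t * y ord0 i - sin t * y ord0 j.
Proof.
move=> ij; rewrite -dotv_evec dotvC dotv_rot dotvC dotv_evec /evec !mxE !eqxx/=.
by rewrite (eq_sym j) (negbTE ij) mulr0n; ring.
Qed.

Lemma rot_j i j t y : i != j ->
  prot i j t y ord0 j = sin t * y ord0 i + cos t * y ord0 j.
Proof.
move=> ij; rewrite -dotv_evec dotvC dotv_rot dotvC dotv_evec /evec !mxE !eqxx/=.
by rewrite (negbTE ij) mulr0n; ring.
Qed.

Lemma dotv_rot_rot i j t x y : i != j ->
  dotv (prot i j t x) (prot i j t y) = dotv x y.
Proof.
move=> ij; rewrite dotv_rot rot_i// rot_j// dotvC dotv_rot (dotvC y).
have := cos2Dsin2 t; set c := cos t; set s := sin t => cs.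
transitivity (dotv x y + (c ^+ 2 + s ^+ 2 - 1) * 
  (x ord0 i * y ord0 i + x ord0 j * y ord0 j)); first by ring.
by rewrite cs subrr mul0r addr0.
Qed.

Lemma sphere_rot i j t y : i != j -> unit_sphere y -> unit_sphere (prot i j t y).
Proof. by move=> ij hy; apply: sphereP; rewrite dotv_rot_rot// sphere_dotv. Qed.

Lemma rotmx_orth i j t : i != j -> rotmx i j t *m (rotmx i j t)^T = 1%:M.
Proof.
move=> ij; apply/matrixP => a b; rewrite !mxE.
transitivity (dotv (prot i j t (evec a)) (prot i j t (evec b))).
  rewrite -!rotmxE -!rowE; apply: eq_bigr => k _; by rewrite !mxE.
by rewrite dotv_rot_rot// dotv_evec mxE eqxx/= eq_sym.
Qed.

Lemma is_derive_dotv_rot i j b y t : i != j ->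
  is_derive t (1 : R) (fun t => dotv b (prot i j t y))
    (b ord0 j * prot i j t y ord0 i - b ord0 i * prot i j t y ord0 j).
Proof.
move=> ij; rewrite rot_i// rot_j//; under eq_fun do rewrite dotv_rot.
apply: is_derive_eq.
rewrite /GRing.scale/=.
ring.
Qed.

End rotations.

(** * Borel measurability on the row space *)

Section borel.
Context {R : realType} {n : nat}.
Local Notation T := (borelRn R n).

Lemma measurable_open (A : set 'rV[R]_n) : open A -> measurable (A : set T).
Proof. by move=> oA; apply: sub_sigma_algebra. Qed.

Lemma measurable_coord i : measurable_fun [set: T] (fun y : T => y ord0 i : R).
Proof.
apply: (measurability _ (RGenOpens.measurableE R)).
move=> _ [_ [a [b ->] <-]]; rewrite setTI; apply: measurable_open.
have /continuousP := @coord_continuous R 1 n ord0 i; apply.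
exact: interval_open.
Qed.

Lemma mulmx_continuous (Q : 'M[R]_n) : continuous (fun y : 'rV[R]_n => y *m Q).
Proof.
move=> x; rewrite /continuous_at mulmx_sum_row.
under eq_cvg do rewrite mulmx_sum_row.
apply: (@cvg_big _ _ _ _ _ _ _ (nbhs x)) => [|i _]; first exact: add_continuous.
apply: (@cvgZr_tmp _ _ _ (nbhs x) _ (fun y : 'rV[R]_n => y ord0 i)).
exact: coord_continuous.
Qed.

Lemma measurable_mulmx (Q : 'M[R]_n) :
  measurable_fun [set: T] (fun y : T => (y *m Q : T)).
Proof.
apply: (@measurability _ _ T T [set: T] _ (@open 'rV[R]_n)); first by [].
move=> _ [A oA <-]; rewrite setTI; apply: measurable_open.
by move: A oA; apply/continuousP; exact: mulmx_continuous.
Qed.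

Lemma measurable_dotv (b : 'rV[R]_n) :
  measurable_fun [set: T] (fun y : T => dotv b y).
Proof.
apply: measurable_sum => i; apply: measurable_funM => //; exact: measurable_coord.
Qed.

Lemma measurable_sqnorm : measurable_fun [set: T] (fun y : T => dotv y y).
Proof.
by apply: measurable_sum => i; apply: measurable_funM => //; exact: measurable_coord.
Qed.

Lemma measurable_sphere : measurable (@unit_sphere R n : set T).
Proof.
rewrite (_ : @unit_sphere R n = [set: T] `&` (fun y : T => dotv y y) @^-1` [set (1 : R)]).
  exact: measurable_sqnorm.
rewrite setTI; apply/seteqP; split => y /=; [exact: sphere_dotv|exact: sphereP].
Qed.

End borel.

(** * The class of integrands: measurable, and bounded on the sphere *)

Section bounded_measurable.
Context {R : realType} {n : nat}.
Local Notation T := (borelRn R n).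
Local Notation S := (@unit_sphere R n).
Implicit Types g h : T -> R.

(** Boundedness is asked on the sphere only: linear forms and negative powers of the distance are
    unbounded on the whole space, but the measure does not see this. *)
Definition bm g := measurable_fun [set: T] g /\
  exists K : R, forall y, S y -> `|g y| <= K.

Lemma bm_cst c : bm (fun=> c).
Proof. by split; [exact: measurable_cst|exists `|c|]. Qed.

Lemma bm_coord i : bm (fun y => y ord0 i).
Proof.
by split; [exact: measurable_coord|exists 1 => y; exact: sphere_coord_le].
Qed.

Lemma bm_dotv b : bm (fun y => dotv b y).
Proof.
split; first exact: measurable_dotv.
by exists (enorm b) => y; exact: sphere_dotv_le.
Qed.

Lemma bmD g h : bm g -> bm h -> bm (fun y => g y + h y).
Proof.
move=> [mg [K Kg]] [mh [L Lh]]; split; first exact: measurable_funD.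
by exists (K + L) => y Sy; rewrite (le_trans (ler_normD _ _))// lerD ?Kg ?Lh.
Qed.

Lemma bmM g h : bm g -> bm h -> bm (fun y => g y * h y).
Proof.
move=> [mg [K Kg]] [mh [L Lh]]; split; first exact: measurable_funM.
by exists (K * L) => y Sy; rewrite normrM ler_pM ?Kg ?Lh.
Qed.

Lemma bmZ c g : bm g -> bm (fun y => c * g y).
Proof. by move=> bg; apply: bmM => //; exact: bm_cst. Qed.

Lemma bmN g : bm g -> bm (fun y => - g y).
Proof.
move=> [mg [K Kg]]; split; first exact: measurableT_comp.
by exists K => y Sy; rewrite normrN Kg.
Qed.

Lemma bmB g h : bm g -> bm h -> bm (fun y => g y - h y).
Proof. by move=> bg bh; apply: bmD => //; exact: bmN. Qed.

Lemma bmX k g : bm g -> bm (fun y => g y ^+ k).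
Proof.
move=> bg; elim: k => [|k IH]; first exact: bm_cst.
by under eq_fun do rewrite exprS; exact: bmM.
Qed.

Lemma bm_sum (I : Type) (s : seq I) (f : I -> T -> R) :
  (forall i, bm (f i)) -> bm (fun y => \sum_(i <- s) f i y).
Proof.
move=> bf; elim: s => [|i s IH].
  by under eq_fun do rewrite big_nil; exact: bm_cst.
by under eq_fun do rewrite big_cons; apply: bmD.
Qed.

Lemma bm_norm g : bm g -> bm (fun y => `|g y|).
Proof.
move=> [mg [K Kg]]; split; first exact: measurableT_comp.
by exists K => y Sy; rewrite normr_id Kg.
Qed.

(** The power is monotone in one direction or the other according to the sign of [c]; the sum of
    both endpoint values covers the two cases at once. *)
Lemma powR_bound (d K c y : R) : 0 < d -> d <= y -> y <= K ->
  y `^ c <= d `^ c + K `^ c.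
Proof.
move=> d0 dy yK; have y0 := lt_le_trans d0 dy; have K0 := lt_le_trans y0 yK.
have [c0|c0] := leP 0 c.
  rewrite ler_wpDl ?powR_ge0// ge0_ler_powR// nnegrE ltW//.
rewrite ler_wpDr ?powR_ge0// -(opprK c) powRN [leRHS]powRN lef_pV2 ?posrE ?powR_gt0//.
apply: ge0_ler_powR => //; rewrite ?nnegrE ?oppr_ge0; exact: ltW.
Qed.

Lemma bm_powR (d c : R) g : 0 < d -> (forall y, S y -> d <= g y) -> bm g ->
  bm (fun y => g y `^ c).
Proof.
move=> d0 dg [mg [K Kg]]; split.
  exact: (@measurableT_comp _ _ _ _ _ _ (@powR R ^~ c)).
exists (d `^ c + K `^ c) => y Sy; rewrite ger0_norm ?powR_ge0//.
by rewrite powR_bound ?dg// (le_trans (ler_norm _))// Kg.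
Qed.

Lemma bm_powR_ge0 (c : R) g : 0 <= c -> (forall y, 0 <= g y) -> bm g ->
  bm (fun y => g y `^ c).
Proof.
move=> c0 g0 [mg [K Kg]]; split.
  exact: (@measurableT_comp _ _ _ _ _ _ (@powR R ^~ c)).
exists (K `^ c) => y Sy; rewrite ger0_norm ?powR_ge0//.
have gK : g y <= K by rewrite (le_trans (ler_norm _))// Kg.
by rewrite ge0_ler_powR// nnegrE// (le_trans _ gK).
Qed.

End bounded_measurable.

(** * Integration over the sphere *)

Section sphere_integral.
Context {R : realType} {n : nat}.
Local Notation T := (borelRn R n).
Local Notation S := (@unit_sphere R n).
Context {mu : {measure set T -> \bar R}}.
Hypothesis Hmu : is_normalized_sphere_measure mu.
Implicit Types g h : T -> R.

(** Restricting the domain to the sphere lets integrands be rewritten with [|y| = 1];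
    [integral_sphere] returns to the whole space, since the complement is null. *)
Definition sphere_int g : R := (\int[mu]_(y in S) g y)%R.

Local Notation sint := sphere_int.

Lemma mu_sphere : mu S = 1%E.
Proof.
have [m1 [m0 _]] := Hmu; rewrite -m1 -(setvU S) measureU//=.
- by rewrite m0 add0e.
- exact: measurableC measurable_sphere.
- exact: measurable_sphere.
- by rewrite setICl.
Qed.

Lemma bm_integrable g : bm g -> mu.-integrable S (EFin \o g).
Proof.
move=> [mg [K Kg]]; apply: measurable_bounded_integrable.
- exact: measurable_sphere.
- by rewrite mu_sphere ltry.
- exact: measurable_funTS.
- exists K; split; first exact: num_real.
  by move=> M KM y Sy /=; rewrite (le_trans (Kg _ Sy))// ltW.
Qed.

Lemma eq_sint g h : (forall y, S y -> g y = h y) -> sint g = sint h.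
Proof. by move=> gh; apply: eq_Rintegral => y; rewrite inE => Sy; exact: gh. Qed.

Lemma sint_cst c : sint (fun=> c) = c.
Proof.
by rewrite /sphere_int Rintegral_cst ?mu_sphere ?mulr1//; exact: measurable_sphere.
Qed.

Lemma sintZ c g : bm g -> sint (fun y => c * g y) = c * sint g.
Proof.
by move=> bg; apply: RintegralZl; [exact: measurable_sphere|exact: bm_integrable].
Qed.

Lemma sintD g h : bm g -> bm h -> sint (fun y => g y + h y) = sint g + sint h.
Proof.
move=> bg bh; apply: RintegralD; first exact: measurable_sphere.
- exact: bm_integrable.
- exact: bm_integrable.
Qed.

Lemma sintB g h : bm g -> bm h -> sint (fun y => g y - h y) = sint g - sint h.
Proof.
move=> bg bh; apply: RintegralB; first exact: measurable_sphere.
- exact: bm_integrable.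
- exact: bm_integrable.
Qed.

Lemma sint_sum (I : Type) (s : seq I) (f : I -> T -> R) :
  (forall i, bm (f i)) ->
  sint (fun y => \sum_(i <- s) f i y) = \sum_(i <- s) sint (f i).
Proof.
move=> bf; elim: s => [|i s IH].
  by rewrite big_nil; under eq_fun do rewrite big_nil; exact: sint_cst.
rewrite big_cons -IH -sintD//; last exact: bm_sum.
by apply: eq_sint => y _; rewrite big_cons.
Qed.

Lemma le_sint g h : bm g -> bm h -> (forall y, S y -> g y <= h y) ->
  sint g <= sint h.
Proof.
move=> bg bh gh; apply: le_Rintegral => //; first exact: measurable_sphere.
- exact: bm_integrable.
- exact: bm_integrable.
Qed.

Lemma sint_gt0 (d : R) g : bm g -> 0 < d -> (forall y, S y -> d <= g y) ->
  0 < sint g.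
Proof.
by move=> bg d0 dg; rewrite (lt_le_trans d0)// -(sint_cst d) le_sint//; exact: bm_cst.
Qed.

Lemma integral_sphere (f : T -> \bar R) : measurable_fun [set: T] f ->
  (\int[mu]_y f y = \int[mu]_(y in S) f y)%E.
Proof.
have [m1 [m0 _]] := Hmu; have mS := @measurable_sphere R n.
move=> mf; rewrite (integral_mkcond (S : set T)); apply: ae_eq_integral => //.
  by apply/(measurable_restrictT _ mS)/measurable_funTS.
exists (~` S); split => //; first exact: measurableC.
move=> y /=; apply: contra_not => Sy _.
by rewrite patchE mem_set.
Qed.

Lemma Rintegral_sphere g : measurable_fun [set: T] g ->
  (\int[mu]_y g y)%R = sint g.
Proof.
by move=> mg; rewrite /sphere_int /Rintegral integral_sphere//; exact/measurable_EFinP.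
Qed.

(** Change of variables along [y *m Q], whose pushforward of [mu] is [mu] by hypothesis and whose
    preimage of the sphere is the sphere. *)
Lemma sint_orth (Q : 'M[R]_n) g : Q *m Q^T = 1%:M -> bm g ->
  sint (fun y => g (y *m Q)) = sint g.
Proof.
move=> QQ [mg [K Kg]]; have [_ [_ inv]] := Hmu.
have mS := @measurable_sphere R n.
have SQ : (fun y : T => (y *m Q : T)) @^-1` S = S.
  have dQ (y : 'rV[R]_n) : dotv (y *m Q) (y *m Q) = dotv y y.
    have E (z : 'rV[R]_n) : dotv z z = (z *m z^T) ord0 ord0.
      by rewrite !mxE; apply: eq_bigr => i _; rewrite !mxE.
    by rewrite !E trmx_mul mulmxA -(mulmxA y) QQ mulmx1.
  by apply/seteqP; split => y /=; rewrite /unit_sphere /= /enorm dQ.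
rewrite /sphere_int /Rintegral; congr fine.
have mE : measurable_fun [set: T] (EFin \o g) by exact/measurable_EFinP.
have := @integral_pushforward _ _ T T R _ (measurable_mulmx Q) mu S _ mE.
rewrite SQ /= => <- //; last first.
  apply: bm_integrable; split; first exact: measurableT_comp (measurable_mulmx Q).
  by exists K => y; rewrite -{1}SQ; exact: Kg.
apply: eq_measure_integral => [|mQ A mA _]; first exact: measurable_mulmx.
exact: inv.
Qed.

(** Domination by an integrable [G], rather than by a constant, admits an unbounded [L^p] density in
    the integrand, as [grad_Pint] requires; [is_derive_sint] is the bounded case. *)
Lemma is_derive_Rintegral_sphere (K K' : R -> T -> R) (G : T -> R) (t0 d : R) :
  0 < d ->
  (forall t, `|t - t0| < d -> mu.-integrable S (EFin \o K t)) ->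
  (forall t y, `|t - t0| < d -> S y -> is_derive t (1 : R) (K ^~ y) (K' t y)) ->
  mu.-integrable S (EFin \o G) -> (forall y, 0 <= G y) ->
  (forall t y, `|t - t0| < d -> S y -> `|K' t y| <= G y) ->
  is_derive t0 (1 : R) (fun t => sint (K t)) (sint (K' t0)).
Proof.
move=> d0 iK dK iG G0 KG.
have I0 : `]t0 - d, t0 + d[%classic t0 by rewrite /= in_itv/= ltrBlDr ltrDl d0.
have II t : `]t0 - d, t0 + d[%classic t -> `|t - t0| < d.
  by rewrite /= in_itv/= ltr_distl.
have d1E t y : `]t0 - d, t0 + d[%classic t -> S y -> partial1of2 K t y = K' t y.
  by move=> /II It Sy; rewrite partial1of2E; have [_ ->] := dK _ _ It Sy.
have dK1 t y : `]t0 - d, t0 + d[%classic t -> S y -> derivable (K ^~ y) t 1.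
  by move=> /II It Sy; have [] := dK _ _ It Sy.
have iK1 t : `]t0 - d, t0 + d[%classic t -> mu.-integrable S (EFin \o K t).
  by move=> /II; exact: iK.
have HG : forall x y, `]t0 - d, t0 + d[%classic x -> S y -> `|partial1of2 K x y| <= G y.
  by move=> x y h Sy; rewrite d1E// KG// II.
have mS := @measurable_sphere R n.
apply: DeriveDef; first exact: (derivable_under_integral mS I0 iK1 dK1 G0 iG HG).
rewrite -derive1E (differentiation_under_integral mS I0 iK1 dK1 G0 iG HG); apply: eq_Rintegral => y; rewrite inE => Sy.
exact: d1E.
Qed.

Lemma is_derive_sint (K K' : R -> T -> R) (t0 d C : R) :
  0 < d -> (forall t, `|t - t0| < d -> bm (K t)) ->
  (forall t y, `|t - t0| < d -> S y -> is_derive t (1 : R) (K ^~ y) (K' t y)) ->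
  (forall t y, `|t - t0| < d -> S y -> `|K' t y| <= C) ->
  is_derive t0 (1 : R) (fun t => sint (K t)) (sint (K' t0)).
Proof.
move=> d0 bK dK KC; apply: (is_derive_Rintegral_sphere (G := fun=> `|C|) d0) => //.
- by move=> t td; apply: bm_integrable; exact: bK.
- exact/bm_integrable/bm_cst.
- by move=> t y td Sy; rewrite (le_trans (KC _ _ td Sy))// ler_norm.
Qed.

End sphere_integral.

(** * Tangential derivatives and the divergence theorem on the sphere *)

Section tangential_derivative.
Context {R : realType} {n : nat}.
Local Notation T := (borelRn R n).
Local Notation S := (@unit_sphere R n).
Implicit Types (g h : T -> R) (G H : T -> 'rV[R]_n).

(* [G] plays the role of the gradient of [g]; only its tangential part along
   the sphere is constrained. *)
Definition tder g G := forall y i j t, S y -> i != j ->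
  is_derive t (1 : R) (fun t => g (prot i j t y))
    (G (prot i j t y) ord0 j * prot i j t y ord0 i
     - G (prot i j t y) ord0 i * prot i j t y ord0 j).

Lemma tder_cst c : tder (fun=> c) (fun=> 0).
Proof.
move=> y i j t Sy ij; rewrite !mxE !mul0r subrr; exact: is_derive_cst.
Qed.

Lemma tder_dotv b : tder (fun y => dotv b y) (fun=> b).
Proof. by move=> y i j t Sy ij; exact: is_derive_dotv_rot. Qed.

Lemma tder_coord j : tder (fun y => y ord0 j) (fun=> evec j).
Proof.
by under eq_fun do rewrite -dotv_evec dotvC; exact: tder_dotv.
Qed.

Lemma tderD g h G H : tder g G -> tder h H ->
  tder (fun y => g y + h y) (fun y => G y + H y).
Proof.
move=> dg dh y i j t Sy ij; rewrite !(rvDE (G _)).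
have h1 := dg _ _ _ t Sy ij; have h2 := dh _ _ _ t Sy ij.
by apply: is_derive_eq; ring.
Qed.

Lemma tderM g h G H : tder g G -> tder h H ->
  tder (fun y => g y * h y) (fun y => g y *: H y + h y *: G y).
Proof.
move=> dg dh y i j t Sy ij; rewrite !(rvDE (_ *: H _)) !rvZE.
have h1 := dg _ _ _ t Sy ij; have h2 := dh _ _ _ t Sy ij.
by apply: is_derive_eq; rewrite /GRing.scale/=; ring.
Qed.

Lemma tderZ c g G : tder g G -> tder (fun y => c * g y) (fun y => c *: G y).
Proof.
move=> dg y i j t Sy ij; rewrite !rvZE.
have h1 := dg _ _ _ t Sy ij.
by apply: is_derive_eq; rewrite /GRing.scale/=; ring.
Qed.

Lemma tder_powR c g G : tder g G -> (forall y, S y -> 0 < g y) ->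
  tder (fun y => g y `^ c) (fun y => (c * g y `^ (c - 1)) *: G y).
Proof.
move=> dg g0 y i j t Sy ij; rewrite !rvZE.
have h1 := dg _ _ _ t Sy ij.
have gr : 0 < g (prot i j t y) by apply/g0/sphere_rot.
have h2 := is_derive1_powR c gr.
apply: (@is_derive_eq _ _ _ _ _ _ _ _ (is_derive1_comp h2 h1)).
by rewrite /GRing.scale/=; ring.
Qed.

Definition bmv G := forall k, bm (fun y => G y ord0 k).

Lemma bmv_cst b : bmv (fun=> b).
Proof. by move=> k; exact: bm_cst. Qed.

Lemma bmvD G H : bmv G -> bmv H -> bmv (fun y => G y + H y).
Proof. by move=> bG bH k; under eq_fun do rewrite mxE; exact: bmD. Qed.

Lemma bmvZ g G : bm g -> bmv G -> bmv (fun y => g y *: G y).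
Proof. by move=> bg bG k; under eq_fun do rewrite mxE; exact: bmM. Qed.

Lemma bm_dotv_field b G : bmv G -> bm (fun y => dotv b (G y)).
Proof. by move=> bG; apply: bm_sum => i; exact/bmZ/bG. Qed.

Lemma bm_dotv_radial G : bmv G -> bm (fun y => dotv y (G y)).
Proof. by move=> bG; apply: bm_sum => i; apply: bmM; [exact: bm_coord|exact: bG]. Qed.

Lemma bm_rot i j t g : i != j -> bm g -> bm (fun y => g (prot i j t y)).
Proof.
move=> ij [mg [K Kg]]; split.
  under eq_fun do rewrite -rotmxE.
  exact: (measurableT_comp mg (measurable_mulmx (rotmx i j t))).
by exists K => y Sy; apply/Kg/sphere_rot.
Qed.

Context {mu : {measure set T -> \bar R}}.
Hypothesis Hmu : is_normalized_sphere_measure mu.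
Local Notation sint := (sphere_int (mu := mu)).

(* Differentiate the invariance of the integral under plane rotations. *)
Lemma sint_rot_generator g G i j : tder g G -> bm g -> bmv G -> i != j ->
  sint (fun y => G y ord0 j * y ord0 i - G y ord0 i * y ord0 j) = 0.
Proof.
move=> dg bg bG ij.
pose w (y : T) := G y ord0 j * y ord0 i - G y ord0 i * y ord0 j.
have bw : bm w by apply: bmB; apply: bmM => //; exact: bm_coord.
have [_ [C wC]] := bw.
have := @is_derive_sint _ _ _ Hmu (fun t y => g (prot i j t y))
  (fun t y => w (prot i j t y)) 0 1 C ltr01.
case.
- by move=> t _; exact: bm_rot.
- by move=> t y _ Sy; exact: dg.
- by move=> t y _ Sy; apply/wC/sphere_rot.
move=> _.
have cst t : sint (fun y => g (prot i j t y)) = sint g.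
  rewrite -(sint_orth Hmu (rotmx_orth t ij) bg); apply: eq_sint => y Sy.
  by rewrite rotmxE.
under eq_fun do rewrite cst.
rewrite derive_cst => ->; apply: eq_sint => y Sy.
by rewrite /prot cos0 sin0 subrr !scale0r !addr0.
Qed.

(** Rotation invariance in the plane of [j] and [i], applied to [y_j * g], and then summed over [j].
    The sum rebuilds the left side because the [y_j ^+ 2] add up to 1; each of the [n - 1] indices
    [j != i] contributes one copy of the integral on the right. *)
Lemma sint_div_coord g G i : tder g G -> bm g -> bmv G ->
  sint (fun y => G y ord0 i - y ord0 i * dotv y (G y)) =
  (n%:R - 1) * sint (fun y => y ord0 i * g y).
Proof.
move=> dg bg bG.
pose w j (y : T) := y ord0 j ^+ 2 * G y ord0 i - y ord0 i * y ord0 j * G y ord0 j.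
have bw j : bm (w j).
  have bc := @bm_coord R n.
  by apply: bmB; apply: bmM => //; [exact: bmX|apply: bmM].
have bgi : bm (fun y => y ord0 i * g y) by apply: bmM => //; exact: bm_coord.
have wj j : j != i -> sint (w j) = sint (fun y => y ord0 i * g y).
  move=> ji; apply/eqP; rewrite -subr_eq0 -sintB//; apply/eqP.
  rewrite -(@sint_rot_generator (fun y => y ord0 j * g y)
    (fun y => y ord0 j *: G y + g y *: evec j) j i) //.
  - apply: eq_sint => y Sy; rewrite !rvDE !rvZE /evec !mxE !eqxx/= eq_sym (negbTE ji) mulr0n /w.
    by ring.
  - by apply: tderM => //; exact: tder_coord.
  - by apply: bmM => //; exact: bm_coord.
  - apply: bmvD; first by apply: bmvZ => //; exact: bm_coord.
    by apply: bmvZ => //; exact: bmv_cst.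
transitivity (sint (fun y => \sum_(j < n) w j y)).
  apply: eq_sint => y Sy.
  have y1 : \sum_(j < n) y ord0 j ^+ 2 = 1 by rewrite -(sphere_dotv Sy).
  rewrite /w big_split/= sumrN -mulr_suml y1 mul1r mulr_sumr; congr (_ - _); apply: eq_bigr => j _.
  by rewrite mulrA.
rewrite sint_sum// (bigD1 i)//=.
rewrite (_ : sint (w i) = 0) ?add0r; last first.
  rewrite -[RHS](sint_cst Hmu 0); apply: eq_sint => y Sy.
  by rewrite /w expr2 subrr.
rewrite (eq_bigr (fun=> sint (fun y => y ord0 i * g y)))//.
rewrite sumr_const -[X in _ *+ X]/(#|predC1 i|) cardC1 card_ord.
have n0 : (0 < n)%N := leq_ltn_trans (leq0n i) (ltn_ord i).
by rewrite -subn1 mulrnBr// mulr1n mulrBl mul1r mulr_natl.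
Qed.

(* Divergence theorem on the sphere for the conformal field [e - <e,y> y]. *)
Lemma sint_div e g G : tder g G -> bm g -> bmv G ->
  sint (fun y => dotv e (G y) - dotv e y * dotv y (G y)) =
  (n%:R - 1) * sint (fun y => dotv e y * g y).
Proof.
move=> dg bg bG.
have bc := @bm_coord R n.
have b1 i : bm (fun y => G y ord0 i - y ord0 i * dotv y (G y)).
  by apply: bmB => //; apply: bmM => //; exact: bm_dotv_radial.
transitivity (sint (fun y => \sum_(i < n) e ord0 i * (G y ord0 i - y ord0 i * dotv y (G y)))).
  apply: eq_sint => y Sy; rewrite {1 2}/dotv mulr_suml -sumrB.
  by apply: eq_bigr => i _; rewrite mulrBr mulrA.
rewrite sint_sum//; last by move=> i; exact: bmZ.
transitivity (\sum_(i < n) (n%:R - 1) * sint (fun y => e ord0 i * (y ord0 i * g y))).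
  apply: eq_bigr => i _; rewrite sintZ// (sint_div_coord _ dg)// sintZ//; first by ring.
  exact: bmM.
rewrite -mulr_sumr -sint_sum//; last by move=> i; apply/bmZ/bmM.
congr (_ * _); apply: eq_sint => y Sy.
by rewrite /dotv mulr_suml; apply: eq_bigr => i _; rewrite mulrA.
Qed.

End tangential_derivative.

(** * Hyperbolic functions and positivity on the light cone *)

Section hyperbolic.
Context {R : realType}.
Implicit Types t : R.

Definition ch t : R := (expR t + expR (- t)) / 2.
Definition sh t : R := (expR t - expR (- t)) / 2.

Lemma is_derive_ch t : is_derive t (1 : R) ch (sh t).
Proof. by apply: is_derive_eq; rewrite /GRing.scale/= /sh; ring. Qed.

Lemma is_derive_sh t : is_derive t (1 : R) sh (ch t).
Proof. by apply: is_derive_eq; rewrite /GRing.scale/= /ch; ring. Qed.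

Lemma ch0 : ch 0 = 1.
Proof. by rewrite /ch oppr0 expR0; field. Qed.

Lemma sh0 : sh 0 = 0.
Proof. by rewrite /sh oppr0 subrr mul0r. Qed.

Lemma expR_le_abs t (C : R) : `|t| <= C -> expR t <= expR C.
Proof. by move=> h; rewrite ler_expR (le_trans (ler_norm _)). Qed.

Lemma abs_ch_le t C : `|t| <= C -> `|ch t| <= expR C.
Proof.
move=> h; have := expR_le_abs h; have := @expR_le_abs (- t) C; rewrite normrN => /(_ h).
have := expR_gt0 t; have := expR_gt0 (- t).
by rewrite /ch => *; rewrite ler_norml; lra.
Qed.

Lemma abs_sh_le t C : `|t| <= C -> `|sh t| <= expR C.
Proof.
move=> h; have := expR_le_abs h; have := @expR_le_abs (- t) C; rewrite normrN => /(_ h).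
have := expR_gt0 t; have := expR_gt0 (- t).
by rewrite /sh => *; rewrite ler_norml; lra.
Qed.

(** The right side is a convex combination of [expR t] and [expR (- t)] with weights [(1 + u) / 2]
    and [(1 - u) / 2]. With [u = <e, y>] it is the time component of the boosted point [(1, y)]. *)
Lemma ch_sh_ge t (u C : R) : `|u| <= 1 -> `|t| <= C -> expR (- C) <= ch t + sh t * u.
Proof.
rewrite ler_norml => /andP[u1 u2] tC.
have h1 : expR (- C) <= expR t.
  by rewrite ler_expR; move: tC; rewrite ler_norml => /andP[].
have h2 : expR (- C) <= expR (- t).
  by rewrite ler_expR lerN2 (le_trans (ler_norm _)).
have -> : ch t + sh t * u = expR t * ((1 + u) / 2) + expR (- t) * ((1 - u) / 2).
  by rewrite /ch /sh; field.
have -> : expR (- C) = expR (- C) * ((1 + u) / 2) + expR (- C) * ((1 - u) / 2) by field.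
by rewrite lerD// ler_wpM2r//; lra.
Qed.

(** Same weights, one with the opposite sign: a boost keeps the light cone in the future
    half-space. *)
Lemma abs_sh_ch_le t (u : R) : `|u| <= 1 -> `|sh t + ch t * u| <= ch t + sh t * u.
Proof.
rewrite ler_norml => /andP[u1 u2].
have p1 : 0 <= expR t * ((1 + u) / 2) by rewrite mulr_ge0 ?expR_ge0//; lra.
have p2 : 0 <= expR (- t) * ((1 - u) / 2) by rewrite mulr_ge0 ?expR_ge0//; lra.
have -> : ch t + sh t * u = expR t * ((1 + u) / 2) + expR (- t) * ((1 - u) / 2).
  by rewrite /ch /sh; field.
have -> : sh t + ch t * u = expR t * ((1 + u) / 2) - expR (- t) * ((1 - u) / 2).
  by rewrite /ch /sh; field.
by rewrite ler_norml; lra.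
Qed.

End hyperbolic.

(** * The convexity inequality behind [J] *)

Section powR_inequality.
Context {R : realType}.

(** Mean value theorem for the [q]-th power on [[b, b + d]], with the derivative bounded by its
    value at the right end. It serves twice: in [Ikap_le], where it creates [J], and in
    [sint_perturb]. *)
Lemma powR_addr_le (b d q : R) : 0 <= b -> 0 <= d -> 1 <= q ->
  (b + d) `^ q <= b `^ q + q * d * (b + d) `^ (q - 1).
Proof.
move=> b0 d0 q1.
have q0 : 0 < q by rewrite (lt_le_trans ltr01).
have [->|dn0] := eqVneq d 0; first by rewrite addr0 mulr0 mul0r addr0.
have {}d0 : 0 < d by rewrite lt_neqAle eq_sym dn0.
have [->|bn0] := eqVneq b 0.
  rewrite add0r powR0 ?gt_eqF// add0r -mulrA mulr_powRB1 ?(ltW d0)//.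
  by rewrite ler_peMl ?powR_ge0.
have {}b0 : 0 < b by rewrite lt_neqAle eq_sym bn0.
have bd : b < b + d by rewrite ltrDl.
have [||c cI E] := @MVT R (fun x => x `^ q) (fun x => q * x `^ (q - 1)) b (b + d) bd.
- move=> x; rewrite in_itv/= => /andP[bx _].
  exact: is_derive1_powR (lt_trans b0 bx).
- apply: derivable_within_continuous => x; rewrite in_itv/= => /andP[bx _].
  have [] // := is_derive1_powR q (lt_le_trans b0 bx).
move: cI; rewrite in_itv/= => /andP[bc cd].
rewrite -lerBlDl E addrAC subrr add0r -mulrA (mulrC (_ `^ _)) mulrA.
rewrite ler_wpM2l ?mulr_ge0 ?(ltW q0) ?(ltW d0)//.
apply: ge0_ler_powR; rewrite ?subr_ge0 ?nnegrE//.
- by rewrite ltW// (lt_trans b0).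
- by rewrite ltW// (lt_trans b0).
- exact: ltW.
Qed.

End powR_inequality.

(** * Conformal weights and invariance under Lorentz boosts *)

Section conformal_weight.
Context {R : realType} {n : nat}.
Local Notation T := (borelRn R n).
Local Notation S := (@unit_sphere R n).
Implicit Types (K L : R -> T -> R).

(** Bounds uniform in [y] and locally uniform in [t] supply the dominating constant for
    differentiation under the integral. The radius can be fixed at 1 because the rapidity ranges
    over all of [R]. *)
Definition locub K := forall t0 : R, exists C : R, forall t y, `|t - t0| < 1 -> S y ->
  `|K t y| <= C.

Definition loclb K := forall t0 : R, exists2 d : R, 0 < d & forall t y,
  `|t - t0| < 1 -> S y -> d <= K t y.

Lemma locubD K L : locub K -> locub L -> locub (fun t y => K t y + L t y).
Proof.
move=> hK hL t0; have [C CK] := hK t0; have [D DL] := hL t0.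
by exists (C + D) => t y ht Sy; rewrite (le_trans (ler_normD _ _))// lerD ?CK ?DL.
Qed.

Lemma locubM K L : locub K -> locub L -> locub (fun t y => K t y * L t y).
Proof.
move=> hK hL t0; have [C CK] := hK t0; have [D DL] := hL t0.
by exists (C * D) => t y ht Sy; rewrite normrM ler_pM ?CK ?DL.
Qed.

Lemma locub_bm g : bm g -> locub (fun _ y => g y).
Proof. by move=> [_ [C gC]] t0; exists C => t y _; exact: gC. Qed.

Lemma near_abs (t t0 : R) : `|t - t0| < 1 -> `|t| <= `|t0| + 1.
Proof.
by move=> h; rewrite -[t](subrK t0) (le_trans (ler_normD _ _))// addrC lerD2l ltW.
Qed.

Lemma locub_ch : locub (fun t _ => ch t).
Proof. by move=> t0; exists (expR (`|t0| + 1)) => t y /near_abs h _; exact: abs_ch_le. Qed.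

Lemma locub_sh : locub (fun t _ => sh t).
Proof. by move=> t0; exists (expR (`|t0| + 1)) => t y /near_abs h _; exact: abs_sh_le. Qed.

Lemma locub_powR c K : locub K -> loclb K -> locub (fun t y => K t y `^ c).
Proof.
move=> hK lK t0; have [C CK] := hK t0; have [d d0 dK] := lK t0.
exists (d `^ c + C `^ c) => t y ht Sy; rewrite ger0_norm ?powR_ge0//.
by rewrite powR_bound ?dK// (le_trans (ler_norm _))// CK.
Qed.

Lemma loclb_gt0 K t y : loclb K -> S y -> 0 < K t y.
Proof.
move=> lK Sy; have [d d0 dK] := lK t.
by rewrite (lt_le_trans d0)// dK// subrr normr0.
Qed.

Lemma loclb_le K t : loclb K -> exists2 d : R, 0 < d & forall y, S y -> d <= K t y.
Proof.
move=> lK; have [d d0 dK] := lK t; exists d => // y Sy.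
by rewrite dK// subrr normr0.
Qed.

Variable e : 'rV[R]_n.
Hypothesis Se : S e.

(* [K t y] solves the transport equation along the conformal field
   [e - <e,y> y], with weight [w]. *)
Definition conf (w : R) K := exists K' (G : R -> T -> 'rV[R]_n),
  [/\ forall t y, S y -> is_derive t (1 : R) (K ^~ y) (K' t y),
      (forall t, tder (K t) (G t)) /\ (forall t, bm (K t)),
      forall t, bmv (G t),
      locub K /\ locub K' &
      forall t y, S y -> K' t y =
        dotv e (G t y) - dotv e y * dotv y (G t y) + w * dotv e y * K t y].

Lemma conf_bm w K t : conf w K -> bm (K t).
Proof. by case=> K' [G [_ [_ bK] _ _ _]]. Qed.

Lemma confD w K L : conf w K -> conf w L -> conf w (fun t y => K t y + L t y).
Proof.
move=> [K' [G [d1 [t1 m1] b1 [l1 l1'] E1]]] [L' [H [d2 [t2 m2] b2 [l2 l2'] E2]]].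
exists (fun t y => K' t y + L' t y), (fun t y => G t y + H t y); split.
- by move=> t y Sy; have h1 := d1 t _ Sy; have h2 := d2 t _ Sy; apply: is_derive_eq.
- by split=> t; [exact: tderD|exact: bmD].
- by move=> t; exact: bmvD.
- by split; exact: locubD.
- by move=> t y Sy; rewrite E1// E2// !dotvDr; ring.
Qed.

(** Both the time derivative and the field are derivations, so by the Leibniz rule the zeroth-order
    terms add; likewise [conf_powR] multiplies the weight by the exponent. *)
Lemma confM w v K L : conf w K -> conf v L -> conf (w + v) (fun t y => K t y * L t y).
Proof.
move=> [K' [G [d1 [t1 m1] b1 [l1 l1'] E1]]] [L' [H [d2 [t2 m2] b2 [l2 l2'] E2]]].
exists (fun t y => K t y * L' t y + L t y * K' t y),
  (fun t y => K t y *: H t y + L t y *: G t y); split.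
- move=> t y Sy; have h1 := d1 t _ Sy; have h2 := d2 t _ Sy; by apply: is_derive_eq.
- by split=> t; [exact: tderM|exact: bmM].
- by move=> t; apply: bmvD; exact: bmvZ.
- by split; [exact: locubM|apply: locubD; exact: locubM].
- by move=> t y Sy; rewrite E1// E2// !dotvDr !dotvZr; ring.
Qed.

Lemma confZ w c K : conf w K -> conf w (fun t y => c * K t y).
Proof.
move=> [K' [G [d1 [t1 m1] b1 [l1 l1'] E1]]].
have lc : locub (fun _ _ => c) by apply: locub_bm; exact: bm_cst.
exists (fun t y => c * K' t y), (fun t y => c *: G t y); split.
- by move=> t y Sy; have h1 := d1 t _ Sy; apply: is_derive_eq.
- by split=> t; [exact: tderZ|exact: bmZ].
- by move=> t; apply: bmvZ => //; exact: bm_cst.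
- by split; exact: locubM.
- by move=> t y Sy; rewrite E1// !dotvZr; ring.
Qed.

Lemma conf_powR w c K : conf w K -> loclb K -> conf (w * c) (fun t y => K t y `^ c).
Proof.
move=> [K' [G [d1 [t1 m1] b1 [l1 l1'] E1]]] lK.
have lc : locub (fun _ _ => c) by apply: locub_bm; exact: bm_cst.
have bp t r : bm (fun y => K t y `^ r).
  by have [d d0 dK] := loclb_le t lK; exact: bm_powR d0 dK _.
exists (fun t y => c * K t y `^ (c - 1) * K' t y),
  (fun t y => (c * K t y `^ (c - 1)) *: G t y); split.
- move=> t y Sy; have h1 := d1 t _ Sy.
  have h2 := is_derive1_powR c (loclb_gt0 t lK Sy).
  by apply: (@is_derive_eq _ _ _ _ _ _ _ _ (is_derive1_comp h2 h1)).
- by split=> // t; apply: tder_powR => // y; exact: loclb_gt0.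
- by move=> t; apply: bmvZ => //; exact/bmZ.
- split; first exact: locub_powR.
  by apply: locubM => //; apply: locubM => //; exact: locub_powR.
- move=> t y Sy; rewrite E1// !dotvZr.
  have -> : K t y `^ c = K t y * K t y `^ (c - 1).
    have K0 := loclb_gt0 t lK Sy.
    by rewrite -{2}(powRr1 (ltW K0)) -powRD ?(gt_eqF K0) ?implybT// addrC subrK.
  by ring.
Qed.

(* [P, Q, m] is a linear form on the light cone of points [(1, y)], pulled back by
   the Lorentz boost of rapidity [t] in direction [e]. *)
Definition bform (P Q : R) (m : 'rV[R]_n) t (y : T) : R :=
  (P * ch t + Q * sh t) + (P * sh t + Q * ch t) * dotv e y + dotv m y.

(** For [A + B <e, y> + <m, y>] the field gives [B (1 - <e, y>^2) - <e, y> <m, y>], using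
    [<e, m> = 0]; adding [<e, y>] times the form leaves [B + A <e, y>], which is its derivative in
    the rapidity. *)
Lemma conf_bform P Q m : dotv e m = 0 -> conf 1 (bform P Q m).
Proof.
move=> em; have bd := @bm_dotv R n.
have cc c : locub (fun _ _ => c) by apply: locub_bm; exact: bm_cst.
have lc := locub_ch; have ls := locub_sh.
have ld b : locub (fun _ y => dotv b y) by apply: locub_bm.
exists (fun t y => (P * sh t + Q * ch t) + (P * ch t + Q * sh t) * dotv e y),
  (fun t y => (P * sh t + Q * ch t) *: e + m); split.
- move=> t y Sy; have := is_derive_ch t; have := is_derive_sh t => h1 h2.
  by apply: is_derive_eq; rewrite /GRing.scale/=; ring.
- split=> t; last first.
    by do 2 (apply: bmD => //); [exact: bm_cst|exact: bmZ].
  pose b := (P * sh t + Q * ch t) *: e + m.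
  have -> : bform P Q m t = fun y => (P * ch t + Q * sh t) + dotv b y.
    by apply/funext => y; rewrite /bform /b dotvDl dotvZl addrA.
  have := tderD (tder_cst (P * ch t + Q * sh t)) (tder_dotv b).
  by under [X in tder _ X -> _]eq_fun do rewrite add0r.
- by move=> t; exact: bmv_cst.
- by split; do ?[apply: locubD => //]; apply: locubM => //; apply: locubD; exact: locubM.
- move=> t y Sy; rewrite !dotvDr !dotvZr (sphere_dotv Se) em (dotvC y e) (dotvC y m).
  by rewrite /bform; ring.
Qed.

(** A covector with [|Q| <= P] is causal, hence nonnegative on the cone: the factor of [Q] is
    dominated by the factor of [P] by [abs_sh_ch_le]. *)
Lemma bform_ge P Q t y C : S y -> `|t| <= C -> `|Q| <= P ->
  (P - `|Q|) * expR (- C) <= bform P Q 0 t y.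
Proof.
move=> Sy tC QP; have u1 : `|dotv e y| <= 1.
  by rewrite -Se; exact: sphere_dotv_le.
have -> : bform P Q 0 t y =
    P * (ch t + sh t * dotv e y) + Q * (sh t + ch t * dotv e y).
  by rewrite /bform (dotvC 0) dotv0; ring.
have h1 := ch_sh_ge u1 tC; have h2 := abs_sh_ch_le t u1.
apply: (@le_trans _ _ ((P - `|Q|) * (ch t + sh t * dotv e y))).
  by rewrite ler_wpM2l// subr_ge0.
rewrite mulrBl lerD2l lerNl -mulrN.
rewrite (le_trans (ler_norm _))// normrM normrN ler_wpM2l//.
Qed.

Lemma loclb_bform P Q : `|Q| < P -> loclb (bform P Q 0).
Proof.
move=> QP t0; exists ((P - `|Q|) * expR (- (`|t0| + 1))).
  by rewrite mulr_gt0 ?expR_gt0 ?subr_gt0.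
by move=> t y /near_abs tC Sy; apply: bform_ge => //; exact: ltW.
Qed.

Context {mu : {measure set T -> \bar R}}.
Hypothesis Hmu : is_normalized_sphere_measure mu.
Local Notation sint := (sphere_int (mu := mu)).

(** The divergence theorem contributes [(n - 1) * int <e, y> K] to the derivative in [t]; the weight
    [1 - n] is the one that cancels it. *)
Lemma sint_conf K t s : conf (1 - n%:R) K -> sint (K t) = sint (K s).
Proof.
move=> [K' [G [d1 [t1 m1] b1 [l1 l1'] E1]]].
apply: (@is_derive_0_is_cst _ (fun t => sint (K t))) => {s}t.
have [C KC] := l1' t.
have := @is_derive_sint _ _ _ Hmu K K' t 1 C ltr01 (fun t _ => m1 t) (fun t y _ Sy => d1 t y Sy) KC.
suff -> : sint (K' t) = 0 by [].
transitivity (sint (fun y => (dotv e (G t y) - dotv e y * dotv y (G t y))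
    + (1 - n%:R) * (dotv e y * K t y))).
  by apply: eq_sint => y Sy; rewrite E1// mulrA.
have bd := @bm_dotv R n.
rewrite sintD//; last 2 first.
- by apply: bmB; [exact: bm_dotv_field|apply: bmM => //; exact: bm_dotv_radial].
- by apply: bmZ; exact: bmM.
rewrite (sint_div Hmu _ (t1 t) (m1 t) (b1 t)) sintZ//; last exact: bmM.
by ring.
Qed.

Lemma sqrt_powR (z q : R) : (z ^+ 2) `^ (q / 2) = `|z| `^ q.
Proof.
rewrite -real_normK ?num_real// -powR_mulrn// -powRrM; congr (_ `^ _).
by field.
Qed.

(* The quadratic perturbation makes [|L|^q] smooth, also at the zeros of [L]. *)
Lemma sint_perturb (w L M : T -> R) (q : R) : 1 <= q ->
  bm w -> bm L -> bm M -> (forall y, S y -> 0 <= w y) ->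
  exists2 C : R, 0 <= C & forall x : R, 0 < x <= 1 ->
  `|sint (fun y => w y * (L y ^+ 2 + x ^+ 2 * M y ^+ 2) `^ (q / 2))
    - sint (fun y => w y * `|L y| `^ q)| <= x * C.
Proof.
move=> q1 bw bL bM w0.
have q0 : 0 < q by rewrite (lt_le_trans ltr01).
have [_ [W hW]] := bw; have [_ [A hA]] := bL; have [_ [B hB]] := bM.
(* The square root of [L^2 + x^2 M^2] is at most [|L| + x |B|]; [C] is what [powR_addr_le] then
   gives with increment [x |B|], after bounding the remaining [x] by 1. *)
pose C := `|W| * (q * `|B| * (`|A| + `|B|) `^ (q - 1)).
exists C; first by rewrite /C !mulr_ge0 ?powR_ge0 ?(ltW q0).
move=> x /andP[x0 x1].
have b1 : bm (fun y => w y * (L y ^+ 2 + x ^+ 2 * M y ^+ 2) `^ (q / 2)).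
  apply: bmM => //; apply: bm_powR_ge0; first by rewrite ltW// divr_gt0.
    by move=> y; rewrite addr_ge0 ?sqr_ge0// mulr_ge0 ?sqr_ge0.
  by apply: bmD; [exact: bmX|apply/bmZ/bmX].
have b2 : bm (fun y => w y * `|L y| `^ q).
  by apply: bmM => //; apply: bm_powR_ge0; [exact: ltW|move=> y; exact: normr_ge0|exact: bm_norm].
have key y : S y ->
  w y * `|L y| `^ q <= w y * (L y ^+ 2 + x ^+ 2 * M y ^+ 2) `^ (q / 2) <= w y * `|L y| `^ q + x * C.
  move=> Sy; apply/andP; split.
    rewrite ler_wpM2l ?w0// -sqrt_powR; apply: ge0_ler_powR.
    - by rewrite ltW// divr_gt0.
    - by rewrite nnegrE sqr_ge0.
    - by rewrite nnegrE addr_ge0 ?sqr_ge0// mulr_ge0 ?sqr_ge0.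
    - by rewrite lerDl mulr_ge0 ?sqr_ge0.
  have h1 : (L y ^+ 2 + x ^+ 2 * M y ^+ 2) `^ (q / 2) <= (`|L y| + x * `|B|) `^ q.
    rewrite -(ger0_norm (_ : 0 <= `|L y| + x * `|B|)) ?addr_ge0 ?mulr_ge0 ?(ltW x0)//.
    rewrite -sqrt_powR; apply: ge0_ler_powR.
    - by rewrite ltW// divr_gt0.
    - by rewrite nnegrE addr_ge0 ?sqr_ge0// mulr_ge0 ?sqr_ge0.
    - by rewrite nnegrE sqr_ge0.
    - rewrite sqrrD real_normK ?num_real// -addrA lerD2l.
      rewrite ler_wpDl ?mulrn_wge0 ?mulr_ge0 ?(ltW x0)// exprMn.
      rewrite ler_wpM2l ?sqr_ge0// real_normK ?num_real//.
      rewrite -(real_normK (num_real (M y))) -(real_normK (num_real B)) ler_pXn2r ?nnegrE//.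
      by rewrite (le_trans (hB _ Sy))// ler_norm.
  have xB : 0 <= x * `|B| by rewrite mulr_ge0 ?(ltW x0).
  have h2 := le_trans h1 (powR_addr_le (normr_ge0 (L y)) xB q1).
  have h3 : (`|L y| + x * `|B|) `^ (q - 1) <= (`|A| + `|B|) `^ (q - 1).
    apply: ge0_ler_powR; rewrite ?subr_ge0 ?nnegrE ?addr_ge0//.
    apply: lerD; first by rewrite (le_trans (hA _ Sy))// ler_norm.
    by rewrite ler_piMl.
  apply: (@le_trans _ _ (w y * (`|L y| `^ q + q * (x * `|B|) * (`|A| + `|B|) `^ (q - 1)))).
    rewrite ler_wpM2l ?w0// (le_trans h2)// lerD2l ler_wpM2l// mulr_ge0// ltW//.
  rewrite mulrDr lerD2l.
  rewrite (_ : x * C = `|W| * (q * (x * `|B|) * (`|A| + `|B|) `^ (q - 1))); last by rewrite /C; ring.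
  rewrite ler_wpM2r ?mulr_ge0 ?powR_ge0 ?(ltW q0) ?(ltW x0)//.
  by rewrite (le_trans (le_trans (ler_norm _) (hW _ Sy)))// ler_norm.
rewrite ger0_norm.
  rewrite lerBlDl -[X in _ <= _ + X](sint_cst Hmu) -sintD//; last exact: bm_cst.
  apply: le_sint => //; first by apply: bmD => //; exact: bm_cst.
  by move=> y /key /andP[].
by rewrite subr_ge0; apply: le_sint => // y /key /andP[].
Qed.

(** The three weights add up to [1 - n], so [sint_conf] would apply if the third form did not vanish
    anywhere. Its square is perturbed by [x ^+ 2] times the square of [bform 1 0 0] and not by a
    constant: this form also has weight 1 and is positive, so homogeneity survives and [x] can tend
    to 0 after the invariance. *)
Lemma sint_boost (P Q P3 Q3 : R) (m : 'rV[R]_n) (a1 a2 q s t : R) :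
  dotv e m = 0 -> `|Q| < P -> 1 <= q -> a1 + a2 + q = 1 - n%:R ->
  sint (fun y => bform P Q 0 t y `^ a1 * bform 1 0 0 t y `^ a2 * `|bform P3 Q3 m t y| `^ q) =
  sint (fun y => bform P Q 0 s y `^ a1 * bform 1 0 0 s y `^ a2 * `|bform P3 Q3 m s y| `^ q).
Proof.
move=> em QP q1 aq.
pose A t' := sint (fun y => bform P Q 0 t' y `^ a1 * bform 1 0 0 t' y `^ a2 * `|bform P3 Q3 m t' y| `^ q).
pose B x t' := sint (fun y => bform P Q 0 t' y `^ a1 * bform 1 0 0 t' y `^ a2 *
    (bform P3 Q3 m t' y ^+ 2 + x ^+ 2 * bform 1 0 0 t' y ^+ 2) `^ (q / 2)).
change (A t = A s).
have l1 : loclb (bform P Q 0) by exact: loclb_bform.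
have l2 : loclb (bform 1 0 0) by apply: loclb_bform; rewrite normr0.
have c1 : conf 1 (bform P Q 0) by apply: conf_bform; rewrite dotv0.
have c2 : conf 1 (bform 1 0 0) by apply: conf_bform; rewrite dotv0.
have c3 : conf 1 (bform P3 Q3 m) by exact: conf_bform.
have c12 := confM (conf_powR a1 c1 l1) (conf_powR a2 c2 l2).
have inv x : 0 < x -> B x t = B x s.
  move=> x0.
  have cN := confD (confM c3 c3) (confZ (x ^+ 2) (confM c2 c2)).
  have lN : loclb (fun t y => bform P3 Q3 m t y * bform P3 Q3 m t y +
      x ^+ 2 * (bform 1 0 0 t y * bform 1 0 0 t y)).
    move=> t0; have [d d0 dl] := l2 t0; exists (x ^+ 2 * (d * d)).
      by rewrite mulr_gt0 ?exprn_gt0 ?mulr_gt0.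
    move=> t1 y h Sy; rewrite ler_wpDl -?expr2 ?sqr_ge0// ler_wpM2l ?sqr_ge0//.
    by rewrite ler_pXn2r ?nnegrE ?dl ?(ltW d0)// (le_trans (ltW d0))// dl.
  have cc := confM c12 (conf_powR (q / 2) cN lN).
  have w1 : (1 * a1 + 1 * a2 + (1 + 1) * (q / 2) : R) = 1 - n%:R by rewrite -aq; field.
  by rewrite w1 in cc; exact: sint_conf cc.
have w0 t' y : 0 <= bform P Q 0 t' y `^ a1 * bform 1 0 0 t' y `^ a2.
  by rewrite mulr_ge0 ?powR_ge0.
have pt t' : exists2 C : R, 0 <= C & forall x : R, 0 < x <= 1 -> `|B x t' - A t'| <= x * C.
  exact: (sint_perturb q1 (conf_bm t' c12) (conf_bm t' c3) (conf_bm t' c2) (fun y _ => w0 t' y)).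
clearbody A B; have [C C0 hC] := pt t; have [D D0 hD] := pt s.
apply/eqP; rewrite -subr_eq0 -normr_eq0; apply/eqP/le_anti; rewrite normr_ge0 andbT.
apply/ler_addgt0Pr => eps eps0; rewrite add0r.
(* The minimum with 1 meets the range of [sint_perturb]; the summand 1 keeps the denominator
   positive when [C] and [D] vanish. *)
pose x := Num.min 1 (eps / (C + D + 1)).
have CD : 0 < C + D + 1 by rewrite ltr_wpDl ?addr_ge0.
have x0 : 0 < x by rewrite lt_min ltr01 divr_gt0.
have x01 : 0 < x <= 1 by rewrite x0 ge_min lexx.
have h1 := hC x x01; have h2 := hD x x01; rewrite -(inv x x0) distrC in h2.
have -> : A t - A s = - ((B x t - A t) + (A s - B x t)) by ring.
rewrite normrN (le_trans (ler_normD _ _))//.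
apply: (@le_trans _ _ (x * C + x * D)); first by rewrite lerD.
rewrite -mulrDr; apply: (@le_trans _ _ (x * (C + D + 1))).
  by rewrite ler_wpM2l ?(ltW x0)// lerDl.
by rewrite -ler_pdivlMr// ge_min lexx orbT.
Qed.

End conformal_weight.

(** * Power series on the open unit disc *)

Section power_series.
Context {R : realType}.
Implicit Types (f g : nat -> R) (z : R).

(* Equivalently, the power series has radius of convergence at least 1. *)
Definition subexp f := forall th : R, 1 < th ->
  exists2 M : R, 0 <= M & forall k, `|f k| <= M * th ^+ k.

Definition ps f z : R := limn (pseries f z).

Lemma subexp_cvg f z : subexp f -> `|z| < 1 -> cvgn (pseries f z).
Proof.
(* Strictly between [|z|] and 1: the growth rate [rho^-1] exceeds 1 and the ratio [|z| / rho] stays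
   below 1. *)
move=> hf z1; pose rho := (1 + `|z|) / 2.
have z0 := normr_ge0 z.
have rho0 : 0 < rho by rewrite /rho; lra.
have rho1 : rho < 1 by rewrite /rho; lra.
have [M M0 hM] := hf rho^-1 ltac:(by rewrite invf_gt1).
apply: normed_cvg; rewrite /normed_series_of.
have zr : `|z| / rho < 1 by rewrite ltr_pdivrMr// mul1r /rho; lra.
apply: (@series_le_cvg _ _ (geometric M (`|z| / rho))).
- by move=> k; exact: normr_ge0.
- by move=> k; rewrite /geometric/= mulr_ge0// exprn_ge0// divr_ge0 ?(ltW rho0).
- move=> k; rewrite /geometric/= normrM normrX exprMn mulrCA [leLHS]mulrC.
  by rewrite ler_wpM2l ?exprn_ge0.
- apply: is_cvg_geometric_series; rewrite ger0_norm// divr_ge0 ?(ltW rho0)//.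
Qed.

Lemma subexp_natS f : subexp f -> subexp (fun k => k.+1%:R * f k).
Proof.
(* The rate is split as [th = t * t]: one factor controls [f], and the other absorbs [k + 1] through
   Bernoulli's inequality. *)
move=> hf th th1; pose t := Num.sqrt th.
have th0 : 0 < th by rewrite (lt_trans ltr01).
have t1 : 1 < t by rewrite -sqrtr1 ltr_sqrt.
have t0 : 0 < t by rewrite (lt_trans ltr01).
have tt : t * t = th by rewrite -expr2 sqr_sqrtr// ltW.
have [M M0 hM] := hf t t1.
have d0 : 0 < t - 1 by rewrite subr_gt0.
exists (M * (t / (t - 1))).
  by rewrite mulr_ge0// divr_ge0 ?(ltW t0) ?(ltW d0).
move=> k; rewrite normrM (ger0_norm (ler0n _ _)).
have bern : forall m : nat, 1 + m%:R * (t - 1) <= t ^+ m.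
  elim=> [|m IH]; first by rewrite mul0r addr0 expr0.
  rewrite exprS; apply: (@le_trans _ _ (t * (1 + m%:R * (t - 1)))); last by rewrite ler_wpM2l// ltW.
  rewrite -natr1 -subr_ge0.
  rewrite (_ : _ - _ = m%:R * (t - 1) ^+ 2); last by ring.
  by rewrite mulr_ge0 ?ler0n// sqr_ge0.
have hk : k.+1%:R <= t / (t - 1) * t ^+ k.
  rewrite mulrAC ler_pdivlMr//.
  by rewrite -exprS (le_trans _ (bern k.+1))// lerDr.
apply: (@le_trans _ _ (t / (t - 1) * t ^+ k * (M * t ^+ k))).
  by apply: ler_pM => //; rewrite ler0n.
rewrite -tt exprMn le_eqVlt; apply/orP; left; apply/eqP; ring.
Qed.

Lemma subexp_shift f : subexp f -> subexp (fun k => f k.+1).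
Proof.
move=> hf th th1; have [M M0 hM] := hf th th1.
have th0 : 0 < th by rewrite (lt_trans ltr01).
exists (M * th); first by rewrite mulr_ge0// ltW.
by move=> k; rewrite (le_trans (hM k.+1))// exprS mulrA.
Qed.

Lemma subexpD f g : subexp f -> subexp g -> subexp (fun k => f k + g k).
Proof.
move=> hf hg th th1; have [M M0 hM] := hf th th1; have [N N0 hN] := hg th th1.
exists (M + N); first exact: addr_ge0.
by move=> k; rewrite mulrDl (le_trans (ler_normD _ _))// lerD.
Qed.

Lemma subexpZ c f : subexp f -> subexp (fun k => c * f k).
Proof.
move=> hf th th1; have [M M0 hM] := hf th th1.
exists (`|c| * M); first exact: mulr_ge0.
by move=> k; rewrite normrM -mulrA ler_wpM2l.
Qed.

Lemma subexp_nat f : subexp f -> subexp (fun k => k%:R * f k).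
Proof.
move=> hf.
have -> : (fun k => k%:R * f k) = (fun k => k.+1%:R * f k + -1 * f k).
  by apply/funext => k; rewrite -natr1; ring.
by apply: subexpD; [exact: subexp_natS|exact: subexpZ].
Qed.

Lemma subexp_diffs f : subexp f -> subexp (pseries_diffs f).
Proof.
move=> hf; have := subexp_shift (subexp_nat hf); exact.
Qed.

Lemma psD f g z : subexp f -> subexp g -> `|z| < 1 ->
  ps (fun k => f k + g k) z = ps f z + ps g z.
Proof.
move=> hf hg z1; have cf := subexp_cvg hf z1; have cg := subexp_cvg hg z1.
rewrite /ps -limD//; congr (limn _); apply/funext => N.
rewrite /pseries /series/= fctE -big_split/=.
by apply: eq_bigr => k _; rewrite mulrDl.
Qed.

Lemma psZ c f z : subexp f -> `|z| < 1 -> ps (fun k => c * f k) z = c * ps f z.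
Proof.
move=> hf z1; have cf := subexp_cvg hf z1.
rewrite /ps; apply: cvg_lim => //.
rewrite (_ : pseries _ z = fun N => c * pseries f z N); first exact: cvgMl_tmp.
apply/funext => N; rewrite /pseries /series/= mulr_sumr.
by apply: eq_bigr => k _; rewrite -mulrA.
Qed.

Lemma ps0 f : ps f 0 = f 0%N.
Proof.
rewrite /ps; apply: cvg_lim => //.
rewrite -(cvg_shiftn 1); apply: cvg_near_cst; apply: nearW => N.
rewrite /pseries /series/= addn1 big_nat_recl//= expr0 mulr1 big1 ?addr0//.
by move=> k _; rewrite expr0n/= mulr0.
Qed.

Lemma ps_shift f z : subexp f -> `|z| < 1 ->
  z * ps (fun k => f k.+1) z = ps f z - f 0%N.
Proof.
move=> hf z1; have cf := subexp_cvg hf z1.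
have cs := subexp_cvg (subexp_shift hf) z1.
have E : (fun N => pseries f z (N + 1)%N) =
    (fun N => z * pseries (fun k => f k.+1) z N + f 0%N).
  apply/funext => N; rewrite /pseries /series/= addn1 big_nat_recl//= expr0 mulr1 addrC.
  congr (_ + _); rewrite mulr_sumr; apply: eq_bigr => k _.
  by rewrite exprS; ring.
have c1 : (fun N => pseries f z (N + 1)%N) @ \oo --> ps f z.
  by rewrite (cvg_shiftn 1).
have c2 : (fun N => pseries f z (N + 1)%N) @ \oo --> z * ps (fun k => f k.+1) z + f 0%N.
  by rewrite E; apply: cvgD; [exact: cvgMl_tmp|exact: cvg_cst].
by rewrite -(cvg_unique _ c2 c1)// addrK.
Qed.

Lemma ps_diffs f z : subexp f -> `|z| < 1 ->
  z * ps (pseries_diffs f) z = ps (fun k => k%:R * f k) z.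
Proof.
move=> hf z1; have := ps_shift (subexp_nat hf) z1.
by rewrite mul0r subr0.
Qed.

Lemma is_derive_ps f z : subexp f -> `|z| < 1 ->
  is_derive z (1 : R) (ps f) (ps (pseries_diffs f) z).
Proof.
move=> hf z1; pose K := (1 + `|z|) / 2.
have z0 := normr_ge0 z.
have K0 : 0 <= K by rewrite /K; lra.
have K1 : `|K| < 1 by rewrite ger0_norm// /K; lra.
apply: (@pseries_snd_diffs _ f K).
- exact: subexp_cvg.
- exact/subexp_cvg/K1/subexp_diffs.
- exact/subexp_cvg/K1/subexp_diffs/subexp_diffs.
- by rewrite (ger0_norm K0) /K; lra.
Qed.

End power_series.

(** * The Gauss series and its differential equation *)

Section hypergeometric.
Context {R : realType}.
Variables (a b c : R).
Hypothesis c0 : 0 < c.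

Definition hcoef k : R := poch a k * poch b k / poch c k / (k`!)%:R.

Lemma pochS (x : R) k : poch x k.+1 = poch x k * (x + k%:R).
Proof. by rewrite /poch big_ord_recr. Qed.

Lemma poch_gt0 k : 0 < poch c k.
Proof. by apply: prodr_gt0 => i _; rewrite ltr_wpDr ?ler0n. Qed.

Lemma hcoefS k : (k%:R + 1) * (c + k%:R) * hcoef k.+1 = (a + k%:R) * (b + k%:R) * hcoef k.
Proof.
have h1 := gt_eqF (poch_gt0 k).
have h2 : c + k%:R != 0 by rewrite gt_eqF// ltr_wpDr ?ler0n.
have h3 : (k`!)%:R != 0 :> R by rewrite pnatr_eq0 -lt0n fact_gt0.
have h4 : (k%:R + 1 : R) != 0 by rewrite natr1 pnatr_eq0.
rewrite /hcoef !pochS factS natrM -natr1.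
by field; rewrite h1 h2 h3 h4.
Qed.

Lemma hyp2F1E z : hyp2F1 a b c z = ps hcoef z.
Proof.
rewrite /hyp2F1 /ps /pseries; congr (limn (series _)); apply/funext => k.
by rewrite /hcoef mulrAC.
Qed.

(** Consecutive coefficients have a ratio with limit 1, so it is at most [th] from an explicit index
    on; the finitely many earlier coefficients go into [M]. *)
Lemma subexp_hcoef : subexp hcoef.
Proof.
move=> th th1.
have th0 : 0 < th by rewrite (lt_trans ltr01).
(* For [k >= 1] one has [(|a| + k) (|b| + k) <= k^2 + D k], and [D k <= (th - 1) k^2] once [k]
   exceeds [D / (th - 1)]; the successor in [k0] guarantees [k >= 1]. *)
pose D := `|a| + `|b| + `|a| * `|b|.
have D0 : 0 <= D by rewrite /D !addr_ge0 ?mulr_ge0.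
pose k0 := (Num.bound (D / (th - 1))).+1.
have ratio k : (k0 <= k)%N -> `|hcoef k.+1| <= th * `|hcoef k|.
  move=> kk.
  have kR : D / (th - 1) < k%:R.
    apply: (lt_le_trans (archi_boundP _)); first by rewrite divr_ge0// subr_ge0 ltW.
    by rewrite ler_nat (leq_trans _ kk).
  have k1 : 1 <= k%:R :> R by rewrite ler1n (leq_trans _ kk).
  have hD : D <= (th - 1) * k%:R by rewrite mulrC -ler_pdivrMr ?subr_gt0// ltW.
  have P : 0 < (k%:R + 1) * (c + k%:R) :> R.
    by apply: mulr_gt0; [rewrite ltr_wpDl ?ler0n|rewrite ltr_wpDr ?ler0n].
  rewrite -(ler_pM2l P) -{1}(gtr0_norm P) -normrM hcoefS normrM mulrCA mulrA.
  rewrite ler_wpM2r//.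
  have ha : `|a + k%:R| <= `|a| + k%:R by rewrite (le_trans (ler_normD _ _))// (ger0_norm (ler0n _ _)).
  have hb : `|b + k%:R| <= `|b| + k%:R by rewrite (le_trans (ler_normD _ _))// (ger0_norm (ler0n _ _)).
  rewrite normrM (le_trans (ler_pM _ _ ha hb))//.
  have aa := normr_ge0 a; have bb := normr_ge0 b.
  have ab : 0 <= `|a| * `|b| by rewrite mulr_ge0.
  have h1 : `|a| * `|b| <= `|a| * `|b| * k%:R by rewrite ler_peMr.
  apply: (@le_trans _ _ (th * (k%:R * k%:R))).
    have h2 : D * k%:R <= (th - 1) * k%:R * k%:R by rewrite ler_wpM2r.
    move: h2 h1; rewrite /D; nra.
  by rewrite ler_wpM2l ?(ltW th0)// ler_pM// ?lerDl ?lerDr ?ler01 ?(ltW c0).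
pose M := \sum_(i < k0.+1) `|hcoef i|.
have M0 : 0 <= M by rewrite sumr_ge0.
have Mi i : (i <= k0)%N -> `|hcoef i| <= M.
  move=> ik; rewrite /M (bigD1 (Ordinal (ik : (i < k0.+1)%N)))//= lerDl sumr_ge0//.
exists M => // k.
have [kk|kk] := leqP k k0.
  by rewrite (le_trans (Mi _ kk))// ler_peMr// exprn_ege1// ltW.
have := ltnW kk; elim: k {kk} => [|k IH].
  by move=> _; rewrite expr0 mulr1 Mi.
rewrite leq_eqVlt => /orP[/eqP <-|].
  by rewrite (le_trans (Mi _ (leqnn _)))// ler_peMr// exprn_ege1// ltW.
rewrite ltnS => kk; rewrite (le_trans (ratio _ kk))// exprS mulrCA ler_wpM2l ?(ltW th0)//.
exact: IH.
Qed.

(** Gauss's equation: the coefficient of [z ^+ k] on the left is the recurrence [hcoefS]. *)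
Lemma hyp_ode z : `|z| < 1 ->
  z * (1 - z) * ps (pseries_diffs (pseries_diffs hcoef)) z
  + (c - (a + b + 1) * z) * ps (pseries_diffs hcoef) z - a * b * ps hcoef z = 0.
Proof.
move=> z1.
have s0 := subexp_hcoef; have s1 := subexp_diffs s0; have s2 := subexp_diffs s1.
have h1 := ps_diffs s0 z1.
have h2 := ps_diffs s1 z1.
have h3 : z * ps (fun k => k%:R * pseries_diffs hcoef k) z =
    ps (fun k => k%:R * (k%:R - 1) * hcoef k) z.
  have e : subexp (fun k => k%:R * (k%:R - 1) * hcoef k).
    have -> : (fun k => k%:R * (k%:R - 1) * hcoef k) =
        (fun k => k%:R * (k%:R * hcoef k) + -1 * (k%:R * hcoef k)).
      by apply/funext => k; ring.
    by apply: subexpD; [|apply: subexpZ]; do ?exact: subexp_nat; exact/subexp_nat/subexp_nat.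
  have := ps_shift e z1; rewrite !mul0r subr0 => <-; congr (_ * ps _ _).
  by apply/funext => k; rewrite /pseries_diffs -natr1; ring.
transitivity (ps (fun k => k%:R * pseries_diffs hcoef k) z
   - ps (fun k => k%:R * (k%:R - 1) * hcoef k) z
   + c * ps (pseries_diffs hcoef) z - (a + b + 1) * ps (fun k => k%:R * hcoef k) z
   - a * b * ps hcoef z).
  by rewrite -h3 -h2 -h1; ring.
have -> : (fun k => k%:R * (k%:R - 1) * hcoef k) =
        (fun k => k%:R * (k%:R * hcoef k) + -1 * (k%:R * hcoef k)).
  by apply/funext => k; ring.
have n1 := subexp_nat s0; have n2 := subexp_nat n1; have n3 := subexp_nat s1.
rewrite psD//; last exact: subexpZ.
rewrite psZ//.
transitivity (ps (fun k => k%:R * pseries_diffs hcoef k + (c * pseries_diffs hcoef k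
   + (-1 * (k%:R * (k%:R * hcoef k)) + (- (a + b) * (k%:R * hcoef k) + - (a * b) * hcoef k)))) z).
  have z4 := subexpZ (- (a * b)) s0.
  have z3 := subexpD (subexpZ (- (a + b)) n1) z4.
  have z2 := subexpD (subexpZ (-1) n2) z3.
  have z5 := subexpD (subexpZ c s1) z2.
  rewrite !psD ?psZ//; do ?exact: subexpZ.
  by ring.
have -> : (fun k => k%:R * pseries_diffs hcoef k + (c * pseries_diffs hcoef k
   + (-1 * (k%:R * (k%:R * hcoef k)) + (- (a + b) * (k%:R * hcoef k) + - (a * b) * hcoef k)))) =
   (fun k => 0 * hcoef k).
  apply/funext => k; have := hcoefS k; rewrite /pseries_diffs -natr1 => h.
  transitivity ((k%:R + 1) * (c + k%:R) * hcoef k.+1 - (a + k%:R) * (b + k%:R) * hcoef k); first by ring.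
  by rewrite h subrr mul0r.
by rewrite psZ// mul0r.
Qed.

End hypergeometric.

(** * The integral of a power of the distance as a hypergeometric function *)

Section zonal_integral.
Context {R : realType} {n : nat}.
Local Notation T := (borelRn R n).
Local Notation S := (@unit_sphere R n).
Context {mu : {measure set T -> \bar R}}.
Hypothesis Hmu : is_normalized_sphere_measure mu.
Local Notation sint := (sphere_int (mu := mu)).
Variable e : 'rV[R]_n.
Hypothesis Se : S e.
Implicit Types (r t c : R) (y : T).

Local Notation u := (dotv e).
(** This is [|r e - y|^2] for [y] on the sphere, written so as to be affine in [<e, y>] and
    polynomial in [r]. *)
Definition qdist r y : R := 1 + r ^+ 2 - 2 * r * u y.

Lemma abs_u_le y : S y -> `|u y| <= 1.
Proof. by move=> Sy; rewrite -Se; exact: sphere_dotv_le. Qed.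

Lemma qdist_ge r (rho : R) y : S y -> `|r| <= rho -> rho < 1 -> (1 - rho) ^+ 2 <= qdist r y.
Proof.
move=> Sy rr r1; have u1 := abs_u_le Sy.
have ru : r * u y <= `|r|.
  by rewrite (le_trans (ler_norm _))// normrM ler_piMr.
apply: (@le_trans _ _ ((1 - `|r|) ^+ 2)).
  by rewrite ler_pXn2r ?nnegrE ?subr_ge0 ?(ltW r1) ?(le_trans rr (ltW r1))// lerD2l lerN2.
rewrite sqrrB real_normK ?num_real// /qdist mul1r expr1n -mulr_natl -mulrA.
lra.
Qed.

Lemma qdist_le r y : S y -> `|r| <= 1 -> qdist r y <= 4.
Proof.
move=> Sy rr; have u1 := abs_u_le Sy.
have ru : `|r * u y| <= 1 by rewrite normrM mulr_ile1.
have r2 : r ^+ 2 <= 1 by rewrite -real_normK ?num_real// expr_le1.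
by move: ru; rewrite ler_norml /qdist => /andP[? ?]; lra.
Qed.

Lemma qdist_gt0 r y : S y -> `|r| < 1 -> 0 < qdist r y.
Proof.
move=> Sy r1; apply: lt_le_trans (qdist_ge Sy (lexx _) r1).
by rewrite exprn_gt0// subr_gt0.
Qed.

Lemma bm_qdist r : bm (qdist r).
Proof. by apply: bmB; [exact: bm_cst|apply: bmZ; exact: bm_dotv]. Qed.

Lemma bm_qdist_powR r c : `|r| < 1 -> bm (fun y => qdist r y `^ c).
Proof.
move=> r1; apply: (@bm_powR _ _ ((1 - `|r|) ^+ 2)); last exact: bm_qdist.
  by rewrite exprn_gt0// subr_gt0.
by move=> y Sy; exact: qdist_ge.
Qed.

Lemma qdist_powR_le r rho c y : S y -> `|r| <= rho -> rho < 1 ->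
  qdist r y `^ c <= ((1 - rho) ^+ 2) `^ c + 4 `^ c.
Proof.
move=> Sy rr r1; apply: powR_bound.
- by rewrite exprn_gt0// subr_gt0.
- exact: qdist_ge.
- by apply: qdist_le => //; rewrite (le_trans rr)// ltW.
Qed.

Lemma qdist_powR_mul r c y : S y -> `|r| < 1 ->
  qdist r y * qdist r y `^ (c - 1) = qdist r y `^ c.
Proof.
move=> Sy r1; have q0 := qdist_gt0 Sy r1.
by rewrite -{1}(powRr1 (ltW q0)) -powRD ?(gt_eqF q0) ?implybT// addrC subrK.
Qed.

Lemma is_derive_qdist_powR c r y : S y -> `|r| < 1 ->
  is_derive r (1 : R) (fun t => qdist t y `^ c)
    (c * qdist r y `^ (c - 1) * (2 * r - 2 * u y)).
Proof.
move=> Sy r1.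
have h1 : is_derive r (1 : R) (fun t => qdist t y) (2 * r - 2 * u y).
  by apply: is_derive_eq; rewrite /GRing.scale/=; ring.
have h2 := is_derive1_powR c (qdist_gt0 Sy r1).
have h3 := @is_derive1_comp R (@powR R ^~ c) (fun t => qdist t y) r _ _ h2 h1.
by apply: (@is_derive_eq _ _ _ _ _ _ _ _ h3).
Qed.

Lemma near_ball1 r t : `|r| < 1 -> `|t - r| < (1 - `|r|) / 2 -> `|t| <= (1 + `|r|) / 2.
Proof.
move=> r1 tr; have := ler_normD (t - r) r; rewrite subrK => h.
by rewrite (le_trans h)//; lra.
Qed.

Lemma abs_du_le t y : S y -> `|t| <= 1 -> `|2 * t - 2 * u y| <= 4.
Proof.
move=> Sy tt; have := abs_u_le Sy; move: tt.
by rewrite !ler_norml => /andP[? ?] /andP[? ?]; lra.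
Qed.

(** [zint1] and [zint2] are the first and second derivatives in [r], taken under the integral. *)
Definition zint c r : R := sint (fun y => qdist r y `^ c).
Definition zint1 c r : R := sint (fun y => c * qdist r y `^ (c - 1) * (2 * r - 2 * u y)).
Definition zint2 c r : R := sint (fun y =>
  c * (c - 1) * qdist r y `^ (c - 2) * (2 * r - 2 * u y) ^+ 2
  + 2 * c * qdist r y `^ (c - 1)).

Lemma is_derive_zint c r : `|r| < 1 -> is_derive r (1 : R) (zint c) (zint1 c r).
Proof.
move=> r1; pose d := (1 - `|r|) / 2; pose rho := (1 + `|r|) / 2.
have d0 : 0 < d by rewrite /d; lra.
have rho1 : rho < 1 by rewrite /rho; lra.
have tr t : `|t - r| < d -> `|t| <= rho by exact: near_ball1.
have tr1 t : `|t - r| < d -> `|t| < 1 by move=> /tr h; rewrite (le_lt_trans h).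
pose C := `|c| * (((1 - rho) ^+ 2) `^ (c - 1) + 4 `^ (c - 1)) * 4.
apply: (@is_derive_sint _ _ _ Hmu (fun t y => qdist t y `^ c)
  (fun r y => c * qdist r y `^ (c - 1) * (2 * r - 2 * u y)) r d C) => //.
- by move=> t /tr1; exact: bm_qdist_powR.
- by move=> t y /tr1 t1 Sy; exact: is_derive_qdist_powR.
- move=> t y td Sy; rewrite !normrM /C.
  rewrite ler_pM// ?mulr_ge0//; last by apply: abs_du_le => //; exact/ltW/tr1.
  by rewrite ler_wpM2l// ger0_norm ?powR_ge0// qdist_powR_le// tr.
Qed.

Lemma is_derive_zint1 c r : `|r| < 1 -> is_derive r (1 : R) (zint1 c) (zint2 c r).
Proof.
move=> r1; pose d := (1 - `|r|) / 2; pose rho := (1 + `|r|) / 2.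
have d0 : 0 < d by rewrite /d; lra.
have rho1 : rho < 1 by rewrite /rho; lra.
have tr t : `|t - r| < d -> `|t| <= rho by exact: near_ball1.
have tr1 t : `|t - r| < d -> `|t| < 1 by move=> /tr h; rewrite (le_lt_trans h).
pose C := `|c * (c - 1)| * (((1 - rho) ^+ 2) `^ (c - 2) + 4 `^ (c - 2)) * 4 ^+ 2
  + `|2 * c| * (((1 - rho) ^+ 2) `^ (c - 1) + 4 `^ (c - 1)).
apply: (@is_derive_sint _ _ _ Hmu (fun r y => c * qdist r y `^ (c - 1) * (2 * r - 2 * u y))
  (fun r y => c * (c - 1) * qdist r y `^ (c - 2) * (2 * r - 2 * u y) ^+ 2
  + 2 * c * qdist r y `^ (c - 1)) r d C) => //.
- move=> t /tr1 t1; apply: bmM; first by apply: bmZ; exact: bm_qdist_powR.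
  by apply: bmB; [exact: bm_cst|apply: bmZ; exact: bm_dotv].
- move=> t y /tr1 t1 Sy.
  have h1 := is_derive_qdist_powR (c - 1) Sy t1.
  apply: is_derive_eq; rewrite /GRing.scale/=.
  rewrite (_ : c - 1 - 1 = c - 2); last by ring.
  by ring.
- move=> t y td Sy; rewrite (le_trans (ler_normD _ _))// /C lerD//.
    rewrite !(normrM _ (_ ^+ 2)) (normrM (c * (c - 1))) normrX.
    rewrite ler_pM ?mulr_ge0 ?exprn_ge0//; last first.
      by rewrite lerXn2r ?nnegrE//; apply: abs_du_le => //; exact/ltW/tr1.
    by rewrite ler_wpM2l// ger0_norm ?powR_ge0// qdist_powR_le// tr.
  rewrite normrM ler_wpM2l// ger0_norm ?powR_ge0//.
  by rewrite qdist_powR_le// tr.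
Qed.

(** The function and its two derivatives are combinations of the three integrals [A], [B] and [Z];
    the divergence theorem relates [Z] to [B], and the equation is a multiple of that relation. *)
Lemma zint_ode c r : `|r| < 1 ->
  r * (1 - r ^+ 2) * zint2 c r
  + ((n%:R - 1) - (3 - n%:R - 4 * c) * r ^+ 2) * zint1 c r
  + 2 * c * (2 - n%:R - 2 * c) * r * zint c r = 0.
Proof.
move=> r1.
have bu := @bm_dotv R n e; have bq k := bm_qdist_powR k r1.
pose A := sint (fun y => qdist r y `^ (c - 1)).
pose B := sint (fun y => u y * qdist r y `^ (c - 1)).
pose Z := sint (fun y => (1 - u y ^+ 2) * qdist r y `^ (c - 2)).
have b1 : bm (fun y => u y * qdist r y `^ (c - 1)) by exact: bmM.
have b2 : bm (fun y => (1 - u y ^+ 2) * qdist r y `^ (c - 2)).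
  by apply: bmM => //; apply: bmB; [exact: bm_cst|exact: bmX].
have eF : zint c r = (1 + r ^+ 2) * A + (- 2 * r) * B.
  rewrite /A /B -!sintZ// -sintD//; do ?exact: bmZ.
  by apply: eq_sint => y Sy; rewrite -qdist_powR_mul// {1}/qdist; ring.
have eF1 : zint1 c r = (2 * c * r) * A + (- 2 * c) * B.
  rewrite /A /B -!sintZ// -sintD//; do ?exact: bmZ.
  by apply: eq_sint => y Sy; ring.
(* Uses [(2 r - 2 u)^2 = 4 qdist - 4 (1 - u^2)]. *)
have eF2 : zint2 c r = (4 * c * (c - 1) + 2 * c) * A + (- 4 * c * (c - 1)) * Z.
  rewrite /A /Z -!sintZ// -sintD//; do ?exact: bmZ.
  apply: eq_sint => y Sy.
  rewrite -(qdist_powR_mul (c - 1) Sy r1) (_ : c - 1 - 1 = c - 2); last by ring.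
  by rewrite {2 4}/qdist; ring.
(* The divergence theorem for [qdist ^ (c - 1)], whose gradient is parallel to [e]; the field
   contributes the factor [1 - u^2]. *)
have eZ : (- 2 * r * (c - 1)) * Z = (n%:R - 1) * B.
  have tq : tder (qdist r) (fun=> (- 2 * r) *: e).
    have := tderD (tder_cst (1 + r ^+ 2)) (tder_dotv ((- 2 * r) *: e)).
    under [X in tder _ X -> _]eq_fun do rewrite add0r.
    rewrite (_ : (fun y => _ + dotv _ y) = qdist r)//.
    by apply/funext => y; rewrite dotvZl /qdist; ring.
  have tp := @tder_powR _ _ (c - 1) _ _ tq (fun y Sy => qdist_gt0 Sy r1).
  rewrite /B -(sint_div Hmu _ tp)//; last first.
    by apply: bmvZ; [apply: bmZ|exact: bmv_cst].
  rewrite /Z -sintZ//; apply: eq_sint => y Sy.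
  rewrite !dotvZr (sphere_dotv Se) (dotvC y) (_ : c - 1 - 1 = c - 2); last by ring.
  by ring.
transitivity (2 * c * (1 - r ^+ 2) * ((- 2 * r * (c - 1)) * Z - (n%:R - 1) * B)).
  by rewrite eF eF1 eF2; ring.
by rewrite eZ subrr mulr0.
Qed.

(** The zero derivative is asked only for [x > 0], because a Wronskian weighted by a power of [x]
    says nothing at 0; derivability bridges the endpoint by continuity. *)
Lemma const_on_ball (f : R -> R) r :
  (forall x : R, `|x| < 1 -> derivable f x 1) ->
  (forall x : R, 0 < x < 1 -> is_derive x (1 : R) f 0) ->
  0 <= r < 1 -> f r = f 0.
Proof.
move=> df f0 /andP[]; rewrite le_eqVlt => /orP[/eqP <-//|r0 r1].
have [||x xr] := @MVT R f (fun=> 0) 0 r r0.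
- move=> x; rewrite in_itv/= => /andP[x0 xr].
  by apply: f0; rewrite x0 (lt_trans xr).
- apply: derivable_within_continuous => x; rewrite in_itv/= => /andP[x0 xr].
  by apply: df; rewrite ger0_norm// (le_lt_trans xr).
by rewrite mul0r => /eqP; rewrite subr_eq0 => /eqP.
Qed.

Hypothesis n2 : (1 < n)%N.

(** Allows division by [zint] in [zint_hyp]. The lower or the upper bound of [qdist] is used
    according to the sign of [c]. *)
Lemma zint_gt0 c r : `|r| < 1 -> 0 < zint c r.
Proof.
move=> r1; rewrite /zint.
have b := bm_qdist_powR c r1.
have d0 : 0 < (1 - `|r|) ^+ 2 by rewrite exprn_gt0// subr_gt0.
have [c0|c0] := leP 0 c.
  apply: (sint_gt0 Hmu b (powR_gt0 c d0)) => y Sy.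
  apply: ge0_ler_powR => //; rewrite ?nnegrE ?(ltW d0)//.
    exact/ltW/qdist_gt0.
  exact: qdist_ge.
apply: (sint_gt0 Hmu b (@powR_gt0 _ 4 c ltac:(lra))) => y Sy.
rewrite -(opprK c) powRN [leRHS]powRN lef_pV2 ?posrE ?powR_gt0 ?qdist_gt0//.
apply: ge0_ler_powR; rewrite ?nnegrE ?oppr_ge0 ?(ltW c0) ?ler0n//.
  exact/ltW/qdist_gt0.
by apply: qdist_le => //; exact: ltW.
Qed.

Lemma zint_hyp c r : 0 <= r < 1 ->
  zint c r = hyp2F1 (- c) (1 - c - n%:R / 2) (n%:R / 2) (r ^+ 2).
Proof.
move=> rr; have n0 : 0 < n%:R / 2 :> R by rewrite divr_gt0// ltr0n ltnW.
rewrite hyp2F1E.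
pose f := hcoef (- c) (1 - c - n%:R / 2) (n%:R / 2).
have sf : subexp f by exact: subexp_hcoef.
have s1 := subexp_diffs sf.
pose Y x := ps f (x ^+ 2).
pose Y1 x := 2 * x * ps (pseries_diffs f) (x ^+ 2).
pose Y2 x := 2 * ps (pseries_diffs f) (x ^+ 2)
  + 4 * x ^+ 2 * ps (pseries_diffs (pseries_diffs f)) (x ^+ 2).
rewrite -/f -/(Y r).
have sq1 (x : R) : `|x| < 1 -> `|x ^+ 2| < 1.
  by move=> x1; rewrite normrX expr_lt1.
have dsq (x : R) : is_derive x (1 : R) (fun x : R => x ^+ 2) (2 * x).
  by apply: is_derive_eq; rewrite /GRing.scale/=; ring.
have dY x : `|x| < 1 -> is_derive x (1 : R) Y (Y1 x).
  move=> x1; have h := is_derive_ps sf (sq1 _ x1).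
  apply: (@is_derive_eq _ _ _ _ _ _ _ _ (@is_derive1_comp R _ (fun x : R => x ^+ 2) x _ _ h (dsq x))).
  by rewrite /Y1 /GRing.scale/= mulrC.
have dY1 x : `|x| < 1 -> is_derive x (1 : R) Y1 (Y2 x).
  move=> x1; have h := is_derive_ps s1 (sq1 _ x1).
  have h2 := @is_derive1_comp R _ (fun x : R => x ^+ 2) x _ _ h (dsq x).
  have h3 : is_derive x (1 : R) (fun x : R => ps (pseries_diffs f) (x ^+ 2))
    (2 * x * ps (pseries_diffs (pseries_diffs f)) (x ^+ 2)).
    by apply: (@is_derive_eq _ _ _ _ _ _ _ _ h2); rewrite /GRing.scale/= mulrC.
  by apply: is_derive_eq; rewrite /Y2 /GRing.scale/=; ring.
have odeY x : `|x| < 1 -> x * (1 - x ^+ 2) * Y2 x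
    + ((n%:R - 1) - (3 - n%:R - 4 * c) * x ^+ 2) * Y1 x
    + 2 * c * (2 - n%:R - 2 * c) * x * Y x = 0.
  move=> x1; have := hyp_ode (- c) (1 - c - n%:R / 2) n0 (sq1 _ x1).
  rewrite -/f /Y2 /Y1 /Y => h.
  by rewrite -[RHS](mulr0 (4 * x)) -h; field.
pose F := zint c; pose F1 := zint1 c; pose F2 := zint2 c.
have dF x : `|x| < 1 -> is_derive x (1 : R) F (F1 x) by exact: is_derive_zint.
have dF1 x : `|x| < 1 -> is_derive x (1 : R) F1 (F2 x) by exact: is_derive_zint1.
have odeF x : `|x| < 1 -> x * (1 - x ^+ 2) * F2 x
    + ((n%:R - 1) - (3 - n%:R - 4 * c) * x ^+ 2) * F1 x
    + 2 * c * (2 - n%:R - 2 * c) * x * F x = 0 by exact: zint_ode.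
have F0 x : `|x| < 1 -> 0 < F x by exact: zint_gt0.
have F00 : F 0 = 1.
  rewrite /F /zint -[RHS](sint_cst Hmu); apply: eq_sint => y Sy.
  by rewrite /qdist expr0n/= addr0 mulr0 mul0r subr0 powR1.
rewrite -/F; clearbody F F1 F2.
have Y00 : Y 0 = 1.
  by rewrite /Y expr0n/= ps0 /f /hcoef /poch !big_ord0 fact0 mulr1 !divr1.
clearbody Y Y1 Y2.
(* Both sides solve the same second-order equation, so [x ^+ n.-1 * (1 - x ^+ 2) `^ g]
   times their Wronskian [W] is constant, and it vanishes at [0]. *)
pose W x := F1 x * Y x - F x * Y1 x.
pose W1 x := F2 x * Y x - F x * Y2 x.
have dW x : `|x| < 1 -> is_derive x (1 : R) W (W1 x).
  move=> x1; have ? := dF _ x1; have ? := dF1 _ x1; have ? := dY _ x1; have ? := dY1 _ x1.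
  by apply: is_derive_eq; rewrite /W1 /GRing.scale/=; ring.
have odeW x : `|x| < 1 ->
  x * (1 - x ^+ 2) * W1 x = - (((n%:R - 1) - (3 - n%:R - 4 * c) * x ^+ 2) * W x).
  move=> x1; apply/eqP; rewrite -subr_eq0 opprK; apply/eqP.
  pose k : R := n%:R - 1 - (3 - n%:R - 4 * c) * x ^+ 2.
  pose l : R := 2 * c * (2 - n%:R - 2 * c) * x.
  transitivity ((x * (1 - x ^+ 2) * F2 x + k * F1 x + l * F x) * Y x
    - (x * (1 - x ^+ 2) * Y2 x + k * Y1 x + l * Y x) * F x).
    by rewrite /W /W1 /k; ring.
  by rewrite /k /l odeF// odeY// !mul0r subrr.
(* Abel's formula: [x^(n - 1) (1 - x^2)^g] is the integrating factor of the first-order equation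
   [odeW]. *)
pose g := 2 - n%:R - 2 * c.
(* Then [x ^+ N.+1] is [x^(n - 1)]; its exponent is positive, so the weighted Wronskian vanishes at
   0. *)
have [N nN] : exists N, n = N.+2 by exists n.-2; case: (n) n2 => [|[|]].
have sq0 (x : R) : `|x| < 1 -> 0 < 1 - x ^+ 2.
  by move=> /sq1 x1; rewrite subr_gt0 (le_lt_trans (ler_norm _)).
pose X x := x ^+ N.+1 * (1 - x ^+ 2) `^ g * W x.
have dX x : `|x| < 1 -> is_derive x (1 : R) X 0.
  move=> x1.
  have h1 : is_derive x (1 : R) (fun x : R => 1 - x ^+ 2) (- 2 * x).
    by apply: is_derive_eq; rewrite /GRing.scale/=; ring.
  have h2 := @is_derive1_comp R (@powR R ^~ g) (fun x : R => 1 - x ^+ 2) x _ _ (is_derive1_powR g (sq0 _ x1)) h1.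
  have h5 := dW _ x1.
  have h4 : is_derive x (1 : R) (fun x : R => x ^+ N.+1) (N.+1%:R * x ^+ N).
    have -> : (fun x : R => x ^+ N.+1) = (@id R : R -> R) ^+ N.+1.
      by apply/funext => z; rewrite exprfctE.
    apply: (@is_derive_eq _ _ _ _ _ _ _ _ (@is_deriveX _ _ id N.+1 x 1 1 (is_derive_id _ _))).
    by rewrite /GRing.scale/= mulr1.
  have h3 : is_derive x (1 : R) (fun x : R => (1 - x ^+ 2) `^ g)
      (g * (1 - x ^+ 2) `^ (g - 1) * (- 2 * x)) by exact: h2.
  apply: (@is_derive_eq _ _ _ _ _ _ _ _ (is_deriveM (is_deriveM h4 h3) h5)).
  rewrite mulrfctE /GRing.scale/=.
  have -> : (1 - x ^+ 2) `^ g = (1 - x ^+ 2) * (1 - x ^+ 2) `^ (g - 1).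
    have q0 := sq0 _ x1.
    by rewrite -{2}(powRr1 (ltW q0)) -powRD ?(gt_eqF q0) ?implybT//; congr (_ `^ _); ring.
  have hn : n%:R = N%:R + 2 :> R by rewrite nN -addn2 natrD.
  transitivity (x ^+ N * (1 - x ^+ 2) `^ (g - 1) * (x * (1 - x ^+ 2) * W1 x
    + ((n%:R - 1) - (3 - n%:R - 4 * c) * x ^+ 2) * W x)); last first.
    by rewrite odeW// addNr mulr0.
  move: (_ `^ (g - 1)) => pw.
  by rewrite /g hn -[N.+1%:R]natr1 (exprS x N); ring.
have X0 x : 0 <= x < 1 -> X x = 0.
  move=> x01; transitivity (X 0); last by rewrite /X exprS !mul0r.
  apply: const_on_ball => //; first by move=> z /dX [].
  by move=> z /andP[z0 z1]; apply: dX; rewrite gtr0_norm.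
have W0 x : 0 < x < 1 -> W x = 0.
  move=> /andP[x0 x1].
  have := X0 x; rewrite (ltW x0) x1 => /(_ isT) /eqP; rewrite /X !mulf_eq0 => /orP[/orP[]|/eqP//].
    by rewrite expf_eq0/= gt_eqF.
  by rewrite gt_eqF// powR_gt0// sq0// gtr0_norm.
have r1 : `|r| < 1 by case/andP: rr => r0 r1; rewrite ger0_norm.
(* A vanishing Wronskian makes the quotient constant, and both functions equal 1 at 0. *)
have : Y r / F r = Y 0 / F 0.
  apply: (@const_on_ball (fun x => Y x / F x)) => // [x x1|x /andP[x0 x1]].
    have [? _] := dY _ x1; have [? _] := dF _ x1.
    have Fn : F x != 0 by rewrite gt_eqF// F0.
    by apply: derivableM; [|exact: derivableV].
  have x1' : `|x| < 1 by rewrite gtr0_norm.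
  have Fn : F x != 0 by rewrite gt_eqF// F0.
  have h1 := dY _ x1'; have h2 := dF _ x1'.
  have h3 := is_deriveV Fn h2.
  apply: is_derive_eq; rewrite /GRing.scale/=.
  transitivity (- W x / F x ^+ 2); first by rewrite /W; field.
  by rewrite W0 ?x0// oppr0 mul0r.
rewrite Y00 F00 divr1 => h.
by rewrite -[LHS]mul1r -h divfK// gt_eqF// F0.
Qed.

End zonal_integral.

(** * The gradient of the Poisson integral *)

Section gradient.
Context {R : realType} {n : nat}.
Local Notation T := (borelRn R n).
Local Notation S := (@unit_sphere R n).
Context {mu : {measure set T -> \bar R}}.
Hypothesis Hmu : is_normalized_sphere_measure mu.
Local Notation sint := (sphere_int (mu := mu)).
Implicit Types (x v l : 'rV[R]_n) (y : T).

Lemma sintD_integrable (f g : T -> R) : mu.-integrable S (EFin \o f) ->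
  mu.-integrable S (EFin \o g) -> sint (fun y => f y + g y) = sint f + sint g.
Proof. by move=> hf hg; apply: RintegralD => //; exact: measurable_sphere. Qed.

Lemma bm_mul_integrable (h phi : T -> R) : bm h -> mu.-integrable S (EFin \o phi) ->
  mu.-integrable S (EFin \o (fun y => h y * phi y)).
Proof.
move=> [mh [C hC]] iphi; have mS := @measurable_sphere R n.
have iC : mu.-integrable S (EFin \o (fun y => C * phi y)).
  by rewrite (_ : _ \o _ = (fun y => C%:E * (EFin \o phi) y)%E) //; exact: integrableZl.
apply: (le_integrable mS _ _ iC).
- apply/measurable_EFinP/measurable_funM; first exact: measurable_funTS.
  by case/integrableP : iphi => /measurable_EFinP.
- move=> y Sy /=; rewrite lee_fin !normrM ler_wpM2r// (le_trans (hC _ Sy))//.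
  exact: ler_norm.
Qed.

Lemma sint_dotv_integrable (h : T -> 'rV[R]_n) (phi : T -> R) l : bmv h ->
  mu.-integrable S (EFin \o phi) ->
  dotv (\row_i sint (fun y => h y ord0 i * phi y)) l = sint (fun y => dotv (h y) l * phi y).
Proof.
move=> bh iphi; rewrite /dotv.
under [in RHS]eq_fun do rewrite mulr_suml.
under eq_bigr do rewrite mxE.
elim: (index_enum _) => [|i s IH].
  by rewrite big_nil; under eq_fun do rewrite big_nil; rewrite sint_cst.
have ii j : mu.-integrable S (EFin \o (fun y => h y ord0 j * l ord0 j * phi y)).
  by apply: bm_mul_integrable => //; apply: bmM => //; exact: bm_cst.
have is' : mu.-integrable S (EFin \o (fun y => \sum_(j <- s) h y ord0 j * l ord0 j * phi y)).
  under eq_fun do rewrite -mulr_suml.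
  by apply: bm_mul_integrable => //; apply: bm_sum => j; apply: bmM => //; exact: bm_cst.
under [in RHS]eq_fun do rewrite big_cons.
rewrite big_cons IH sintD_integrable//; congr (_ + _).
rewrite mulrC /sphere_int -RintegralZl//; last 2 first.
- exact: measurable_sphere.
- exact: bm_mul_integrable.
by apply: eq_sint => y _; ring.
Qed.

Lemma derive_line (f : 'rV[R]_n -> R) x v :
  'D_v f x = 'D_1 (fun t : R => f (t *: v + x)) 0.
Proof.
rewrite /derive; congr (lim (_ @ 0^')); apply/funext => t /=.
by rewrite !addr0 scale0r add0r /GRing.scale/= mulr1.
Qed.

Lemma enormB_powR x y (k : R) : enorm (x - y) `^ k = dotv (x - y) (x - y) `^ (k / 2).
Proof. by rewrite /enorm -powR12_sqrt ?dotv_ge0// -powRrM mulrC. Qed.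

Lemma dotvBB x y : dotv (x - y) (x - y) = dotv x x - 2 * dotv x y + dotv y y.
Proof. by rewrite dotvBr !dotvBl (dotvC y x); ring. Qed.

Lemma measurable_sqdist x : measurable_fun [set: T] (fun y => dotv (x - y) (x - y)).
Proof.
under eq_fun do rewrite dotvBB.
apply: measurable_funD; last exact: measurable_sqnorm.
apply: measurable_funB => //; apply: measurable_funM => //; exact: measurable_dotv.
Qed.

Variable a : R.
Local Notation k := (n%:R - a).

Lemma PkerE x y : Pker a x y =
  Cna n a * (1 - dotv x x) `^ (1 - a) * dotv (x - y) (x - y) `^ (- (k / 2)).
Proof. by rewrite /Pker enormB_powR powRN enorm_sqr. Qed.

Lemma measurable_Pker x : measurable_fun [set: T] (Pker a x).
Proof.
rewrite (_ : Pker a x = fun y => Cna n a * (1 - dotv x x) `^ (1 - a) *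
    dotv (x - y) (x - y) `^ (- (k / 2))); last by apply/funext => y; exact: PkerE.
apply: measurable_funM => //.
exact: (measurableT_comp (@measurable_powR R _) (measurable_sqdist x)).
Qed.

Lemma dotv_line x i t : dotv (t *: evec i + x) (t *: evec i + x) =
  dotv x x + 2 * t * x ord0 i + t ^+ 2.
Proof.
rewrite dotvDr !dotvDl !dotvZr !dotvZl !dotv_evec (dotvC (evec i)) dotv_evec.
by rewrite mxE !eqxx/=; ring.
Qed.

Lemma sqdist_ge x y (rho : R) : S y -> enorm x <= rho -> rho <= 1 ->
  (1 - rho) ^+ 2 <= dotv (x - y) (x - y).
Proof.
move=> Sy xr r1; rewrite dotvBB (sphere_dotv Sy) -enorm_sqr.
have := sphere_dotv_le x Sy; have := enorm_ge0 x => h0.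
rewrite ler_norml => /andP[_ h]; nra.
Qed.

Lemma sqdist_le x y : S y -> enorm x <= 1 -> dotv (x - y) (x - y) <= 4.
Proof.
move=> Sy x1; rewrite dotvBB (sphere_dotv Sy) -enorm_sqr.
have := sphere_dotv_le x Sy; have := enorm_ge0 x => h0.
rewrite ler_norml => /andP[h _]; nra.
Qed.

Lemma enorm_coord_le x i : `|x ord0 i| <= enorm x.
Proof.
by rewrite -dotv_evec (le_trans (dotv_cauchy _ _))// (sphere_evec i) mulr1.
Qed.

Lemma enorm_line_le x i t : enorm (t *: evec i + x) <= enorm x + `|t|.
Proof.
rewrite -(ler_pXn2r (_ : 0 < 2)%N)// ?nnegrE ?addr_ge0 ?enorm_ge0//.
rewrite enorm_sqr dotv_line sqrrD enorm_sqr real_normK ?num_real// lerD2r lerD2l.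
rewrite -mulrA -[leRHS]mulr_natl ler_wpM2l// mulrC (le_trans (ler_norm _))// normrM.
by rewrite ler_wpM2r// enorm_coord_le.
Qed.

(** The gradient of [Pker a x y] in [x], with the common powers factored out. For [y] on the sphere
    the remaining bracket is affine in [y], that is, linear on the light cone, which is what the
    boost needs. *)
Definition dPker x y : 'rV[R]_n :=
  (Cna n a * (1 - dotv x x) `^ (- a) * dotv (x - y) (x - y) `^ (- (k / 2) - 1)) *:
  ((- 2 * (1 - a) * dotv (x - y) (x - y)) *: x - (k * (1 - dotv x x)) *: (x - y)).

Lemma is_derive_Pker_line x i y t : S y -> enorm (t *: evec i + x) < 1 ->
  is_derive t (1 : R) (fun t => Pker a (t *: evec i + x) y)
    (dPker (t *: evec i + x) y ord0 i).
Proof.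
move=> Sy z1.
pose N1 (t : R) := 1 - (dotv x x + 2 * t * x ord0 i + t ^+ 2).
pose D (t : R) := (dotv x x + 2 * t * x ord0 i + t ^+ 2) - 2 * (dotv x y + t * y ord0 i) + 1.
have eN t' : 1 - dotv (t' *: evec i + x) (t' *: evec i + x) = N1 t'.
  by rewrite dotv_line.
have eD t' : dotv (t' *: evec i + x - y) (t' *: evec i + x - y) = D t'.
  rewrite dotvBB dotv_line (sphere_dotv Sy) /D dotvDl dotvZl (dotvC (evec i)) dotv_evec.
  by ring.
have N0 : 0 < N1 t by rewrite -eN -enorm_sqr subr_gt0 expr_lt1// enorm_ge0.
have D0 : 0 < D t.
  rewrite -eD; apply: lt_le_trans (sqdist_ge Sy (lexx _) (ltW z1)).
  by rewrite exprn_gt0// subr_gt0.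
have -> : (fun t => Pker a (t *: evec i + x) y) =
    (fun t => Cna n a * (N1 t `^ (1 - a) * D t `^ (- (k / 2)))).
  by apply/funext => t'; rewrite PkerE eN eD mulrA.
have dN : is_derive t (1 : R) N1 (- 2 * (x ord0 i + t)).
  by apply: is_derive_eq; rewrite /GRing.scale/=; ring.
have dD : is_derive t (1 : R) D (2 * (x ord0 i + t - y ord0 i)).
  by apply: is_derive_eq; rewrite /GRing.scale/=; ring.
have h1 := @is_derive1_comp R (@powR R ^~ (1 - a)) N1 t _ _ (is_derive1_powR (1 - a) N0) dN.
have h2 := @is_derive1_comp R (@powR R ^~ (- (k / 2))) D t _ _ (is_derive1_powR (- (k / 2)) D0) dD.
have h3 := is_deriveM h1 h2.
have h4 := @is_deriveZ _ _ _ _ (Cna n a) _ _ _ h3.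
apply: (@is_derive_eq _ _ _ _ _ _ _ _ h4).
rewrite /dPker eN eD /GRing.scale/= !mxE !eqxx/= mulr1n.
have e1 : 1 - a - 1 = - a by ring.
rewrite e1.
have -> : N1 t `^ (1 - a) = N1 t * N1 t `^ (- a).
  by rewrite -{2}(powRr1 (ltW N0)) -powRD ?(gt_eqF N0) ?implybT.
have -> : D t `^ (- (k / 2)) = D t * D t `^ (- (k / 2) - 1).
  by rewrite -{2}(powRr1 (ltW D0)) -powRD ?(gt_eqF D0) ?implybT//; congr (_ `^ _); ring.
by field.
Qed.

(** Uniformity over the smaller ball of radius [rho] makes [M * |phi|] a dominating function near
    [x] in [grad_Pint]. *)
Lemma dPker_bound (rho : R) i : 0 <= rho < 1 -> exists2 M : R, 0 <= M &
  forall z y, S y -> enorm z <= rho -> `|dPker z y ord0 i| <= M.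
Proof.
move=> /andP[rho0 rho1].
pose M := `|Cna n a| * ((1 - rho ^+ 2) `^ (- a) + 1 `^ (- a)) *
  (((1 - rho) ^+ 2) `^ (- (k / 2) - 1) + 4 `^ (- (k / 2) - 1)) *
  (`|- 2 * (1 - a)| * 4 * 1 + `|k| * 1 * 2).
exists M; first by rewrite /M !mulr_ge0 ?addr_ge0 ?powR_ge0 ?mulr_ge0.
move=> z y Sy zr; rewrite /dPker rvZE rvDE rvNE !rvZE.
have z1 : enorm z <= 1 by rewrite (le_trans zr) ?ltW.
have zi : `|z ord0 i| <= 1 by rewrite (le_trans (enorm_coord_le _ _)).
have yi := sphere_coord_le i Sy.
have N0 : dotv z z <= rho ^+ 2 by rewrite -enorm_sqr lerXn2r// nnegrE ?enorm_ge0.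
have N1 := dotv_ge0 z.
have D1 := sqdist_ge Sy zr (ltW rho1).
have D4 := sqdist_le Sy z1.
have r2 : rho ^+ 2 < 1 by rewrite expr_lt1.
have r20 : 0 < (1 - rho) ^+ 2 by rewrite exprn_gt0// subr_gt0.
rewrite normrM /M; apply: ler_pM => //.
  rewrite normrM (ger0_norm (powR_ge0 _ _)); apply: ler_pM; rewrite ?powR_ge0//.
    rewrite normrM (ger0_norm (powR_ge0 _ _)) ler_wpM2l//.
    by apply: powR_bound; lra.
  exact: powR_bound.
rewrite (le_trans (ler_normD _ _))// lerD//.
  rewrite normrM ler_pM// normrM ler_wpM2l// ger0_norm//.
  by rewrite (le_trans (ltW r20)).
rewrite normrN normrM ler_pM//.
  by rewrite normrM ler_wpM2l// ler_norml; lra.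
rewrite rvDE rvNE; move: zi yi; rewrite !ler_norml => /andP[? ?] /andP[? ?]; lra.
Qed.

Lemma bmv_dPker x : enorm x < 1 -> bmv (dPker x).
Proof.
move=> x1 i; split; last first.
  have [|M _ hM] := @dPker_bound (enorm x) i; first by rewrite enorm_ge0.
  by exists M => y Sy; exact: hM.
have mD := measurable_sqdist x.
rewrite /dPker; under eq_fun do rewrite rvZE rvDE rvNE !rvZE rvDE rvNE.
apply: measurable_funM; first apply: measurable_funM => //.
  exact: (measurableT_comp (@measurable_powR R _) mD).
apply: measurable_funB.
  by apply: measurable_funM => //; apply: measurable_funM.
apply: measurable_funM => //; apply: measurable_funB => //.
exact: measurable_coord.
Qed.

Lemma bm_Pker x : enorm x < 1 -> bm (Pker a x).
Proof.
move=> x1; split; first exact: measurable_Pker.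
exists (`|Cna n a| * (1 - dotv x x) `^ (1 - a) *
  (((1 - enorm x) ^+ 2) `^ (- (k / 2)) + 4 `^ (- (k / 2)))) => y Sy.
rewrite PkerE !normrM !(ger0_norm (powR_ge0 _ _)) ler_wpM2l ?mulr_ge0 ?powR_ge0//.
apply: powR_bound; first by rewrite exprn_gt0// subr_gt0.
- exact: sqdist_ge (ltW x1).
- exact: sqdist_le (ltW x1).
Qed.

Lemma grad_Pint x (phi : T -> R) : unit_ball x -> measurable_fun [set: T] phi ->
  mu.-integrable S (EFin \o phi) ->
  grad (Pint mu a phi) x = \row_i sint (fun y => dPker x y ord0 i * phi y).
Proof.
move=> x1 mphi iphi; have {}x1 : enorm x < 1 by [].
apply/rowP => i; rewrite !mxE derive_line.
pose d := (1 - enorm x) / 2; pose rho := (1 + enorm x) / 2.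
have x0 := enorm_ge0 x.
have d0 : 0 < d by rewrite /d; lra.
have rho01 : 0 <= rho < 1 by rewrite /rho; lra.
have zr t : `|t - 0| < d -> enorm (t *: evec i + x) <= rho.
  by rewrite subr0 => td; rewrite (le_trans (enorm_line_le _ _ _))//; move: td; rewrite /d /rho; lra.
have z1 t : `|t - 0| < d -> enorm (t *: evec i + x) < 1.
  by move=> /zr h; rewrite (le_lt_trans h)//; case/andP: rho01.
have [M M0 hM] := dPker_bound i rho01.
have iM : mu.-integrable S (EFin \o (fun y => M * `|phi y|)).
  apply: bm_mul_integrable; first exact: bm_cst.
  exact: integrable_norm.
have dd := @is_derive_Rintegral_sphere _ _ mu (fun t y => Pker a (t *: evec i + x) y * phi y)
  (fun t y => dPker (t *: evec i + x) y ord0 i * phi y) (fun y => M * `|phi y|) 0 d d0.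
have -> : (fun t : R => Pint mu a phi (t *: delta_mx ord0 i + x)) =
    (fun t : R => sint (fun y => Pker a (t *: evec i + x) y * phi y)).
  apply/funext => t; rewrite /Pint Rintegral_sphere//.
  by apply: measurable_funM => //; exact: measurable_Pker.
have [| | | | |_ ->] := dd.
- by move=> t td; apply: bm_mul_integrable => //; apply: bm_Pker; exact: z1.
- move=> t y td Sy; have h := is_derive_Pker_line Sy (z1 _ td).
  by apply: is_derive_eq; rewrite /GRing.scale/=; ring.
- exact: iM.
- by move=> y; rewrite mulr_ge0.
- by move=> t y td Sy; rewrite normrM ler_wpM2r// hM// zr.
- by apply: eq_sint => y Sy; rewrite scale0r add0r.
Qed.

Lemma dotv_grad_Pint x l (phi : T -> R) : unit_ball x -> measurable_fun [set: T] phi ->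
  mu.-integrable S (EFin \o phi) ->
  dotv (grad (Pint mu a phi) x) l = sint (fun y => dotv (dPker x y) l * phi y).
Proof.
move=> x1 mphi iphi; rewrite grad_Pint// sint_dotv_integrable//.
exact: bmv_dPker.
Qed.

End gradient.

(** * Hölder's inequality and its extremal functions *)

Section duality.
Context {R : realType} {n : nat}.
Local Notation T := (borelRn R n).
Local Notation S := (@unit_sphere R n).
Context {mu : {measure set T -> \bar R}}.
Hypothesis Hmu : is_normalized_sphere_measure mu.
Local Notation sint := (sphere_int (mu := mu)).
Implicit Types (h phi : T -> R).

Lemma integral_bm h : bm h -> (\int[mu]_y (h y)%:E = (sint h)%:E)%E.
Proof.
move=> bh; rewrite integral_sphere//; last by case: bh => /measurable_EFinP.
rewrite /sphere_int /Rintegral fineK//.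
by apply: integrable_fin_num; [exact: measurable_sphere|exact: bm_integrable].
Qed.

Lemma bm_norm_powR h (q : R) : 0 <= q -> bm h -> bm (fun y => `|h y| `^ q).
Proof. by move=> q0 bh; apply: bm_powR_ge0 => //; exact: bm_norm. Qed.

Lemma Lnorm_bm h (q : R) : 0 <= q -> bm h ->
  Lnorm mu q%:E (EFin \o h) = ((sint (fun y => `|h y| `^ q)) `^ q^-1)%:E.
Proof.
move=> q0 bh; rewrite unlock /= (integral_bm (bm_norm_powR q0 bh)).
by rewrite poweR_EFin.
Qed.

Lemma sint_ge0 h : (forall y, S y -> 0 <= h y) -> 0 <= sint h.
Proof. by move=> h0; exact: Rintegral_ge0. Qed.

Variables (p : \bar R) (q : R).
Hypotheses (p1 : (1 < p)%E) (q1 : 1 <= q).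
Hypothesis pq : (p = +oo%E /\ q = 1) \/ (exists p' : R, p = p'%:E /\ p'^-1 + q^-1 = 1).

Let q0 : 0 < q. Proof. exact: lt_le_trans q1. Qed.

(** Two real exponents are a case of [hoelder]; for [p = +oo] and [q = 1] the density is replaced
    almost everywhere by its essential supremum. *)
Lemma hoelder_sphere h phi : bm h -> in_Lp mu p phi ->
  (\int[mu]_y `|(h y * phi y)%:E| <=
   ((sint (fun y => `|h y| `^ q)) `^ q^-1)%:E * Lnorm mu p (EFin \o phi))%E.
Proof.
move=> bh [mphi fphi]; have mh := bh.1.
case: pq => [[pE qE]|[p' [pE p'q]]].
  move: fphi; rewrite pE qE unlock; have [mu1 _] := Hmu.
  rewrite mu1 lte01.
  set N := ess_sup _ _ => Nfin.
  have N0 : (0 <= N)%E.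
    by apply: ess_sup_gee; [rewrite mu1 lte01|apply: nearW => y; exact: abse_ge0].
  have NE : N = (fine N)%:E by rewrite fineK// fin_numElt Nfin (lt_le_trans _ N0).
  have bN : bm (fun y => `|h y| * fine N) by apply: bmM; [exact: bm_norm|exact: bm_cst].
  rewrite invr1 powRr1; last by apply: sint_ge0 => y _; exact: powR_ge0.
  rewrite NE -EFinM.
  have -> : sint (fun y => `|h y| `^ 1) * fine N = sint (fun y => `|h y| * fine N).
    rewrite mulrC -sintZ//; last exact: bm_norm_powR.
    by apply: eq_sint => y _; rewrite powRr1// mulrC.
  rewrite -integral_bm//; apply: ae_ge0_le_integral => //.
  - by apply: measurableT_comp => //; apply/measurable_EFinP/measurable_funM.
  - by move=> y _; rewrite lee_fin mulr_ge0// fine_ge0.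
  - by apply/measurable_EFinP; case: bN.
  have := @ess_sup_ge _ _ _ mu (abse \o (EFin \o phi)).
  apply: filterS => y /=; rewrite -/N NE lee_fin => hy _.
  by rewrite lee_fin normrM ler_wpM2l.
have p'0 : 0 < p' by move: p1; rewrite pE lte_fin; exact: lt_trans.
rewrite pE -(Lnorm_bm (ltW q0) bh).
have := @hoelder _ _ _ mu h phi q p' mh mphi q0 p'0.
by rewrite addrC => /(_ p'q); rewrite Lnorm1.
Qed.

Lemma Lnorm_fineK phi : in_Lp mu p phi -> Lnorm mu p (EFin \o phi) = (Lpnorm mu p phi)%:E.
Proof.
by move=> [_ f]; rewrite /Lpnorm fineK// ge0_fin_numE// Lnorm_ge0.
Qed.

Lemma Lp_integrable phi : in_Lp mu p phi -> mu.-integrable S (EFin \o phi).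
Proof.
move=> iphi; apply: (@integrableS _ _ _ _ [set: T]) => //; first exact: measurable_sphere.
apply/integrableP; split; first by apply/measurable_EFinP; case: iphi.
have := hoelder_sphere (bm_cst 1) iphi; rewrite (Lnorm_fineK iphi) -EFinM.
move=> h; apply: le_lt_trans (ltry _); apply: le_trans h.
by rewrite le_eqVlt; apply/orP; left; apply/eqP/eq_integral => y _; rewrite mul1r.
Qed.

Lemma hoelder_sint h phi : bm h -> in_Lp mu p phi ->
  `|sint (fun y => h y * phi y)| <=
   (sint (fun y => `|h y| `^ q)) `^ q^-1 * Lpnorm mu p phi.
Proof.
move=> bh iphi; have ih := bm_mul_integrable bh (Lp_integrable iphi).
apply: (le_trans (le_normr_Rintegral measurable_sphere ih)).
have H := hoelder_sphere bh iphi; move: H.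
rewrite (Lnorm_fineK iphi) -EFinM integral_sphere//; last first.
  apply: measurableT_comp => //; apply/measurable_EFinP/measurable_funM; first by case: bh.
  by case: iphi.
rewrite /Rintegral -lee_fin => H; apply: le_trans H; rewrite fineK//.
have mS := @measurable_sphere R n.
have := integrable_fin_num mS (integrable_norm ih); exact.
Qed.

(** For [p = +oo] a bound valid everywhere is asked, since [bm] bounds [h] on the sphere only; the
    applications are a sign function and the constant 1. *)
Lemma bm_in_Lp h : bm h -> (p = +oo%E -> forall y, `|h y| <= 1) -> in_Lp mu p h.
Proof.
move=> bh h1; split; first by case: bh.
case: pq => [[pE qE]|[p' [pE p'q]]].
  rewrite pE unlock; have [-> _] := Hmu; rewrite lte01.
  apply: (@le_lt_trans _ _ 1%E); last exact: ltry.
  by apply/ess_supP/nearW => y /=; rewrite lee_fin h1.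
have p'0 : 0 < p' by move: p1; rewrite pE lte_fin; exact: lt_trans.
by rewrite pE (Lnorm_bm (ltW p'0) bh) ltry.
Qed.

(** The density [|h|^(q - 1) sgn h] attains equality in Hölder's inequality, with
    [1 - q^-1 = 1 / p]. The norm is only bounded above because for [q = 1] the sign may vanish
    almost everywhere. *)
Lemma hoelder_extremal h : bm h -> exists phi, [/\ in_Lp mu p phi,
  sint (fun y => h y * phi y) = sint (fun y => `|h y| `^ q) &
  Lpnorm mu p phi <= (sint (fun y => `|h y| `^ q)) `^ (1 - q^-1)].
Proof.
move=> bh; pose phi y := `|h y| `^ (q - 1) * Num.sg (h y).
have q10 : 0 <= q - 1 by rewrite subr_ge0.
have bsg : bm (fun y => Num.sg (h y)).
  have mh := bh.1; split.
    rewrite (_ : (fun y => _) = (fun y => if 0 < h y then 1 else if h y < 0 then -1 else 0)).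
      apply: measurable_fun_if => //; first exact: measurable_fun_ltr.
      apply: measurable_funTS; apply: measurable_fun_if => //.
      exact: measurable_fun_ltr.
    by apply/funext => y; case: sgrP.
  by exists 1 => y _; rewrite normr_sg; case: (_ != _).
have bphi : bm phi by apply: bmM => //; exact: bm_norm_powR.
have aphi y : q != 1 -> `|phi y| = `|h y| `^ (q - 1).
  move=> qn1; rewrite /phi normrM normr_sg (ger0_norm (powR_ge0 _ _)).
  case: eqVneq => [->|]; last by rewrite mulr1.
  by rewrite normr0 powR0 ?mul0r// subr_eq0.
have iphi : in_Lp mu p phi.
  apply: bm_in_Lp => // pE y; case: pq => [[_ qE]|[p' [pE']]]; last by rewrite pE' in pE.
  rewrite /phi qE subrr powRr0 mul1r normr_sg; by case: (_ != _).
exists phi; split => //.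
  apply: eq_sint => y _; rewrite /phi mulrCA (mulrC (h y)) -normrEsg mulrC.
  exact: mulr_powRB1.
case: pq => [[pE qE]|[p' [pE p'q]]].
  rewrite qE invr1 subrr powRr0 -lee_fin -(Lnorm_fineK iphi) pE unlock.
  have [-> _] := Hmu; rewrite lte01.
  apply/ess_supP/nearW => y /=; rewrite lee_fin.
  by rewrite /phi qE subrr powRr0 mul1r normr_sg; case: (_ != _).
have p'1 : 1 < p' by move: p1; rewrite pE lte_fin.
have p'0 : 0 < p' by exact: lt_trans p'1.
have p'V : p'^-1 = 1 - q^-1 by rewrite -p'q addrK.
have qn1 : q != 1.
  apply/eqP => qE; move: p'V; rewrite qE invr1 subrr => /eqP.
  by rewrite invr_eq0 gt_eqF.
rewrite -lee_fin -(Lnorm_fineK iphi) pE (Lnorm_bm (ltW p'0) bphi) lee_fin -p'V.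
suff -> : sint (fun y => `|phi y| `^ p') = sint (fun y => `|h y| `^ q) by [].
apply: eq_sint => y _; rewrite aphi// -powRrM; congr (_ `^ _).
have -> : p' = (1 - q^-1)^-1 by rewrite -p'V invrK.
by field; rewrite gt_eqF//= subr_eq0 qn1.
Qed.

End duality.

(** * The Moebius change of variables, the bound and its sharpness *)

Section optimal_constant.
Context {R : realType} {n : nat}.
Local Notation T := (borelRn R n).
Local Notation S := (@unit_sphere R n).
Context {mu : {measure set T -> \bar R}}.
Hypothesis Hmu : is_normalized_sphere_measure mu.
Local Notation sint := (sphere_int (mu := mu)).
Implicit Types (x l : 'rV[R]_n) (y : T).
Variables (a q : R).
Hypotheses (n3 : (3 <= n)%N) (a1 : a < 1) (q1 : 1 <= q).

Local Notation k := (n%:R - a).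
Local Notation C := (Cna n a).
Local Notation beta := (k * q - 2 * n%:R + 2).
Local Notation kap := ((2 - a - n%:R) / k).

Let q0 : 0 < q. Proof. exact: lt_le_trans q1. Qed.

Let k0 : 0 < k.
Proof. by rewrite subr_gt0 (lt_trans a1)// ltr1n (leq_trans _ n3). Qed.

Lemma Cna_ge0 : 0 <= C.
Proof.
have G s : 0 <= Gamma (s : R).
  by apply: Rintegral_ge0 => t _; rewrite mulr_ge0 ?powR_ge0 ?expR_ge0.
by rewrite /Cna divr_ge0// mulr_ge0.
Qed.

Lemma exists_direction x : exists2 e, S e & x = enorm x *: e.
Proof.
have [x0|xn0] := eqVneq (enorm x) 0.
  pose i : 'I_n := Ordinal (leq_trans (isT : (0 < 3)%N) n3).
  exists (evec i); first exact: sphere_evec.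
  rewrite x0 scale0r; apply/rowP => j; rewrite mxE; apply/eqP.
  by rewrite -normr_le0 -x0 enorm_coord_le.
exists ((enorm x)^-1 *: x); last by rewrite scalerA divff// scale1r.
apply: sphereP; rewrite dotvZl dotvZr -enorm_sqr; field.
by rewrite xn0.
Qed.

Lemma enormB_sym x y : enorm (y - x) = enorm (x - y).
Proof. by rewrite /enorm -(opprB x y) dotvNl dotvNr opprK. Qed.

Lemma bm_dist_powR x (c : R) : unit_ball x -> bm (fun y => enorm (y - x) `^ c).
Proof.
move=> x1; have {}x1 : enorm x < 1 by [].
under eq_fun do rewrite enormB_sym enormB_powR.
split; first exact: (measurableT_comp (@measurable_powR R _) (measurable_sqdist x)).
exists (((1 - enorm x) ^+ 2) `^ (c / 2) + 4 `^ (c / 2)) => y Sy.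
rewrite (ger0_norm (powR_ge0 _ _)); apply: powR_bound.
- by rewrite exprn_gt0// subr_gt0.
- exact: sqdist_ge (ltW x1).
- exact: sqdist_le (ltW x1).
Qed.

Lemma sqdist_qdist e (r : R) y : S e -> S y ->
  dotv (r *: e - y) (r *: e - y) = qdist e r y.
Proof.
move=> Se Sy; rewrite dotvBB !dotvZl dotvZr (sphere_dotv Se) (sphere_dotv Sy) /qdist.
by ring.
Qed.

Definition Kfac x : R := k * C / (1 - enorm x ^+ 2) `^ ((n%:R * (q - 1) + 1) / q).

(** [Ifun] with the shift by [kappa x] retained; [Kfac x * Ikap x l ^ (1 / q)] is the exact norm of
    the functional sending [phi] to [<grad u (x), l>]. *)
Definition Ikap x l : R := sint (fun y =>
  enorm (y - x) `^ beta * `|dotv y l + kap * dotv x l| `^ q).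

Lemma bm_lin x l : bm (fun y => `|dotv y l + kap * dotv x l| `^ q).
Proof.
apply: bm_norm_powR; first exact: ltW.
by under eq_fun do rewrite dotvC; apply: bmD; [exact: bm_dotv|exact: bm_cst].
Qed.

(** This rapidity has hyperbolic half-angle tangent [r]; its boost turns [|r e - y|^2] into a
    constant. *)
Lemma ch_ln_ratio (r : R) : 0 <= r < 1 ->
  ch (ln ((1 + r) / (1 - r))) = (1 + r ^+ 2) / (1 - r ^+ 2) /\
  sh (ln ((1 + r) / (1 - r))) = 2 * r / (1 - r ^+ 2).
Proof.
move=> /andP[r0 r1].
have p1 : 0 < 1 + r by rewrite ltr_wpDr.
have p2 : 0 < 1 - r by rewrite subr_gt0.
have n1 := lt0r_neq0 p1; have n2 := lt0r_neq0 p2.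
have n3' : 1 - r ^+ 2 != 0 by rewrite (_ : 1 - r ^+ 2 = (1 + r) * (1 - r)) ?mulf_neq0//; ring.
by rewrite /ch /sh expRN lnK ?posrE ?divr_gt0//; split; field; rewrite ?n1 ?n2 ?n3'.
Qed.

Lemma bform0 e P Q (m : 'rV[R]_n) y : bform e P Q m 0 y = P + Q * dotv e y + dotv m y.
Proof. by rewrite /bform ch0 sh0; ring. Qed.

Lemma bform_qdist e (r : R) y : bform e (1 + r ^+ 2) (- 2 * r) 0 0 y = qdist e r y.
Proof. by rewrite bform0 (dotvC 0) dotv0 /qdist; ring. Qed.

Lemma bform_one e y : bform e 1 0 0 0 y = 1 :> R.
Proof. by rewrite bform0 (dotvC 0) dotv0; ring. Qed.

Lemma norm_prod_powR (A D B s t : R) : 0 <= A ->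
  `|A * D `^ s * B| `^ t = A `^ t * (D `^ (s * t) * `|B| `^ t).
Proof.
move=> A0; have D0 := powR_ge0 D s.
by rewrite !normrM (ger0_norm A0) (ger0_norm D0) !powRM ?mulr_ge0// powRrM mulrA.
Qed.

Lemma boost_factor (v K Q B s t p : R) : 0 < v -> 0 <= K -> 0 <= Q -> 0 <= B ->
  v `^ s * (Q / v) `^ t * (K * B) `^ p =
  v `^ s * (v `^ t)^-1 * K `^ p * (Q `^ t * B `^ p).
Proof.
move=> v0 K0 Q0 B0; have v1 : 0 <= v^-1 by rewrite invr_ge0 ltW.
rewrite (powRM _ Q0 v1) (powRM _ K0 B0) -(powR_inv1 (ltW v0)) -powRrM mulN1r powRN.
by ring.
Qed.

(** Collects the powers of [v = 1 - |x|^2] from the kernel, the two boosted weights and the linear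
    form; this is where the exponent [(n (q - 1) + 1) / q] of the theorem arises. *)
Lemma const_factor (v K D b s t p N : R) : 0 < v -> 0 <= K -> 0 <= D ->
  - b * p + s - t + p = - (N * p) ->
  (D * v `^ (- b)) `^ p * (v `^ s * (v `^ t)^-1 * (K * v) `^ p) = (K * D / v `^ N) `^ p.
Proof.
move=> v0 K0 D0 E; have v1 := ltW v0.
have vn : v != 0 by rewrite gt_eqF.
have vD (c d : R) : v `^ c * v `^ d = v `^ (c + d) by rewrite powRD// vn implybT.
rewrite -!powRN (powRM _ (mulr_ge0 K0 D0) (powR_ge0 _ _)) (powRM _ K0 D0).
rewrite (powRM _ D0 (powR_ge0 _ _)) (powRM _ K0 v1) -!powRrM.
rewrite (_ : - N * p = - b * p + s - t + p); last by rewrite E; ring.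
by rewrite -!vD; ring.
Qed.

(* The boost of rapidity [ln ((1 + r) / (1 - r))] followed by [y -> - y] is the
   Moebius involution exchanging [x] and the origin. *)
Lemma sint_dPker x l : unit_ball x ->
  sint (fun y => `|dotv (dPker a x y) l| `^ q) = Kfac x `^ q * Ikap x l.
Proof.
move=> xb; have {}xb : enorm x < 1 by [].
have [e Se xE] := exists_direction x.
set r := enorm x in xE xb *; have r0 : 0 <= r by exact: enorm_ge0.
have w0 : 0 < 1 - r ^+ 2 by rewrite subr_gt0 expr_lt1.
set w := 1 - r ^+ 2.
have xx : dotv x x = r ^+ 2 by rewrite -enorm_sqr.
pose le := dotv e l; pose m0 := l - le *: e.
have em0 : dotv e m0 = 0 by rewrite dotvBr dotvZr (sphere_dotv Se) mulr1 subrr.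
have xl : dotv x l = r * le by rewrite xE dotvZl.
have yl y : dotv y l = le * dotv e y + dotv m0 y.
  by rewrite dotvBl dotvZl (dotvC y l) addrC subrK.
(* [P3], [Q3] and [m] are the coefficients of the bracket of [dPker], paired with [l], in 1,
   [<e, y>] and the directions orthogonal to [e]. *)
pose P3 := - 2 * (1 - a) * (1 + r ^+ 2) * r * le - k * w * r * le.
pose Q3 := 4 * (1 - a) * r ^+ 2 * le + k * w * le.
pose m := (k * w) *: m0.
have em : dotv e m = 0 by rewrite dotvZr em0 mulr0.
(* [b1] is dictated by the kernel; [b2] completes the degree to [1 - n] and sits on a form equal to
   1 before the boost. *)
pose b1 := (- (k / 2) - 1) * q; pose b2 := beta / 2.
have r1' : `|r| < 1 by rewrite ger0_norm.
have QP : `|- 2 * r| < 1 + r ^+ 2.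
  rewrite normrM normrN (ger0_norm r0) ger0_norm// -subr_gt0.
  rewrite (_ : _ - _ = (1 - r) ^+ 2); last by ring.
  by rewrite exprn_gt0// subr_gt0.
have De z : S z -> dotv (x - z) (x - z) = qdist e r z.
  by move=> Sz; rewrite xE sqdist_qdist.
have bsum : b1 + b2 + q = 1 - n%:R by rewrite /b1 /b2; field.
have [chT shT] := ch_ln_ratio (introT andP (conj r0 xb)).
set T0 := ln _ in chT shT.
have B := sint_boost Se Hmu P3 Q3 T0 0 em QP q1 bsum.
have wn : w != 0 by rewrite gt_eqF.
have kn : k != 0 by rewrite gt_eqF.
pose g0 y := bform e (1 + r ^+ 2) (-2 * r) 0 0 y `^ b1 *
    bform e 1 0 0 0 y `^ b2 * `|bform e P3 Q3 m 0 y| `^ q.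
have L1 : sint (fun y => `|dotv (dPker a x y) l| `^ q) =
  (C * w `^ (- a)) `^ q * sint g0.
  transitivity (sint (fun y => (C * w `^ (- a)) `^ q * g0 y)); last first.
    apply: (sintZ Hmu); rewrite /g0.
    apply: bmM; last first.
      apply: bm_norm_powR; first exact: ltW.
      exact: (conf_bm 0 (conf_bform Se P3 Q3 em)).
    apply: bmM.
      under eq_fun do rewrite bform_qdist.
      exact: (bm_qdist_powR Se b1 r1').
    under eq_fun do rewrite bform_one powR1.
    exact: bm_cst.
  apply: eq_sint => y Sy.
  rewrite /g0 bform_qdist bform_one powR1 mulr1 bform0.
  have D0 : 0 <= dotv (x - y) (x - y) by exact: dotv_ge0.
  have C0 := Cna_ge0.
  have Cw : 0 <= C * w `^ (- a) by rewrite mulr_ge0 ?powR_ge0.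
  rewrite /dPker dotvZl xx -/w (norm_prod_powR _ _ _ _ Cw) -/b1 (De _ Sy).
  do 2 congr (_ * _); congr (`|_| `^ _).
  rewrite dotvBl !dotvZl dotvBl xl yl /qdist /P3 /Q3 /m ?dotvZl.
  by ring.
pose gT y := bform e (1 + r ^+ 2) (-2 * r) 0 T0 y `^ b1 *
    bform e 1 0 0 T0 y `^ b2 * `|bform e P3 Q3 m T0 y| `^ q.
have L2 : sint gT =
  sint (fun y => w `^ b1 * (w `^ b2)^-1 * (k * w) `^ q * (enorm (- y - x) `^ beta *
     `|dotv (- y) l + kap * dotv x l| `^ q)).
  apply: eq_sint => y Sy.
  have SNy : S (- y) by apply: sphereP; rewrite dotvNl dotvNr opprK sphere_dotv.
  rewrite /gT /bform (dotvC 0) dotv0 chT shT -/w.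
  (* The images of the three forms: the squared distance becomes constant, 1 becomes a squared
     distance, and in the third [k - 2 (1 - a) = n + a - 2] yields [kappa]. *)
  have e1 : (1 + r ^+ 2) * ((1 + r ^+ 2) / w) + -2 * r * (2 * r / w) +
     ((1 + r ^+ 2) * (2 * r / w) + -2 * r * ((1 + r ^+ 2) / w)) * dotv e y + 0 = w.
    by rewrite /w; field; rewrite -/w.
  have e2 : 1 * ((1 + r ^+ 2) / w) + 0 * (2 * r / w) +
     (1 * (2 * r / w) + 0 * ((1 + r ^+ 2) / w)) * dotv e y + 0 = qdist e r (- y) / w.
    by rewrite /qdist dotvNr; field.
  have e3 : P3 * ((1 + r ^+ 2) / w) + Q3 * (2 * r / w) +
     (P3 * (2 * r / w) + Q3 * ((1 + r ^+ 2) / w)) * dotv e y + dotv m y =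
     - (k * w) * (dotv (- y) l + kap * dotv x l).
    rewrite dotvNl yl xl /m dotvZl /P3 /Q3 /w; field.
    by rewrite kn -/w wn.
  rewrite e1 e2 e3 normrM normrN (ger0_norm (mulr_ge0 (ltW k0) (ltW w0))).
  have Q0 : 0 <= qdist e r (- y) by apply/ltW/qdist_gt0; rewrite ?ger0_norm.
  rewrite (boost_factor _ _ _ w0 (mulr_ge0 (ltW k0) (ltW w0)) Q0 (normr_ge0 _)).
  by rewrite enormB_sym enormB_powR (De _ SNy).
have {}B : sint gT = sint g0 by exact: esym B.
clearbody g0 gT; rewrite L1 -B L2 {B L1 L2 g0 gT}.
have bI : bm (fun y => enorm (y - x) `^ beta * `|dotv y l + kap * dotv x l| `^ q).
  by apply: bmM; [exact: bm_dist_powR|exact: bm_lin].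
have NN : (- 1%:M : 'M[R]_n) *m (- 1%:M)^T = 1%:M.
  by rewrite linearN/= mulNmx mulmxN opprK trmx1 mulmx1.
have F : sint (fun y => enorm (- y - x) `^ beta * `|dotv (- y) l + kap * dotv x l| `^ q) = Ikap x l.
  rewrite /Ikap -(sint_orth Hmu NN bI); apply: eq_sint => y _.
  by rewrite mulmxN mulmx1.
have bF : bm (fun y : T => enorm (- y - x) `^ beta * `|dotv (- y) l + kap * dotv x l| `^ q).
  have [mI [K hK]] := bI; split.
    have := measurableT_comp mI (measurable_mulmx (- 1%:M)).
    by congr measurable_fun; apply/funext => y /=; rewrite mulmxN mulmx1.
  exists K => y Sy; apply: hK.
  by apply: sphereP; rewrite dotvNl dotvNr opprK sphere_dotv.
rewrite (sintZ Hmu _ bF) F mulrA; congr (_ * _).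
have E : - a * q + b1 - b2 + q = - ((n%:R * (q - 1) + 1) / q * q).
  by rewrite /b1 /b2; field; rewrite gt_eqF.
rewrite /Kfac -/r -/w.
exact: (const_factor w0 (ltW k0) Cna_ge0 E).
Qed.

Lemma IfunE x l : unit_ball x ->
  Ifun mu a q x l = sint (fun y => enorm (y - x) `^ beta * `|dotv y l| `^ q).
Proof.
move=> xb; rewrite /Ifun Rintegral_sphere//.
apply: measurable_funM; first by have [] := bm_dist_powR beta xb.
have h : bm (fun y => `|dotv l y| `^ q).
  by apply: bm_norm_powR; [exact: ltW|exact: bm_dotv].
have [] := h => + _; congr measurable_fun; apply/funext => y.
by rewrite dotvC.
Qed.

(** [zint_hyp] with [c = beta / 2], which explains the parameters of the hypergeometric factor of
    [J]. *)
Lemma dist_powR_hyp x : unit_ball x ->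
  sint (fun y => enorm (y - x) `^ beta) =
  hyp2F1 (n%:R - 1 - q * k / 2) ((n%:R - q * k) / 2) (n%:R / 2) (enorm x ^+ 2).
Proof.
move=> xb; have [e Se xE] := exists_direction x.
have xb' : 0 <= enorm x < 1 by rewrite enorm_ge0.
transitivity (zint (mu := mu) e (beta / 2) (enorm x)).
  by apply: eq_sint => y Sy; rewrite enormB_sym enormB_powR {1 2}xE sqdist_qdist.
rewrite (zint_hyp Hmu Se _ _ xb'); last exact: ltn_trans n3.
have e1 : - (beta / 2) = n%:R - 1 - q * k / 2 by field.
have e2 : 1 - beta / 2 - n%:R / 2 = (n%:R - q * k) / 2 by field.
by rewrite e2 e1.
Qed.

Lemma bm_dist_dot x l : unit_ball x ->
  bm (fun y => enorm (y - x) `^ beta * `|dotv y l| `^ q).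
Proof.
move=> xb; apply: bmM; first exact: bm_dist_powR.
under eq_fun do rewrite dotvC.
by apply: bm_norm_powR; [exact: ltW|exact: bm_dotv].
Qed.

(** [powR_addr_le] with [b = |<y, l>|] and [d = |kappa| |x|]; since [b <= 1] the correction is a
    constant times the weight, which [dist_powR_hyp] integrates. *)
Lemma Ikap_le x l : unit_ball x -> S l -> Ikap x l <= Ifun mu a q x l + Jfun a q x.
Proof.
move=> xb Sl; rewrite (IfunE _ xb).
pose d := `|kap| * enorm x.
have d0 : 0 <= d by rewrite mulr_ge0 ?enorm_ge0.
have JE : Jfun a q x = sint (fun y => q * d * (1 + d) `^ (q - 1) * enorm (y - x) `^ beta).
  rewrite (sintZ Hmu _ (bm_dist_powR _ xb)) dist_powR_hyp// /Jfun.
  have -> : `|2 - a - n%:R| / k = `|kap| by rewrite normrM (gtr0_norm (_ : 0 < k^-1)) ?invr_gt0.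
  by rewrite -/d; congr (_ * _ * _); rewrite /d; ring.
have bE := bm_dist_powR beta xb; have bd := bm_dist_dot l xb.
have bZ := bmZ (q * d * (1 + d) `^ (q - 1)) bE.
rewrite JE -(sintD Hmu bd bZ); apply: le_sint => //.
- by apply: bmM => //; exact: bm_lin.
- exact: bmD.
move=> y Sy; rewrite (mulrC (q * d * _)) -mulrDr ler_wpM2l ?powR_ge0//.
have yl : `|dotv y l| <= 1.
  by rewrite (le_trans (sphere_dotv_le _ Sl))// (Sy : enorm y = 1).
have xl : `|kap * dotv x l| <= d.
  by rewrite normrM ler_wpM2l// sphere_dotv_le.
apply: (@le_trans _ _ ((`|dotv y l| + d) `^ q)).
  apply: ge0_ler_powR; rewrite ?nnegrE ?(ltW q0) ?addr_ge0//.
  by rewrite (le_trans (ler_normD _ _))// lerD2l.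
rewrite (le_trans (powR_addr_le (normr_ge0 _) d0 q1))// lerD2l.
apply: (ler_wpM2l (mulr_ge0 (ltW q0) d0)).
by apply: ge0_ler_powR; rewrite ?nnegrE ?subr_ge0 ?addr_ge0// lerD2r.
Qed.

(** The shift [kappa x] vanishes, so the only lossy step is exact; with [Jfun_eq0] this gives
    sharpness. *)
Lemma Ikap_eq x l : unit_ball x -> x = 0 \/ a = 2 - n%:R -> Ikap x l = Ifun mu a q x l.
Proof.
move=> xb h; rewrite (IfunE _ xb); apply: eq_sint => y Sy.
have -> : kap * dotv x l = 0; last by rewrite addr0.
case: h => [->|->]; first by rewrite (dotvC 0) dotv0 mulr0.
by rewrite (_ : 2 - (2 - n%:R) - n%:R = 0) ?mul0r//; ring.
Qed.

Lemma Jfun_eq0 x : x = 0 \/ a = 2 - n%:R -> Jfun a q x = 0.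
Proof.
case=> [->|aE]; rewrite /Jfun.
  by rewrite /enorm dotv0 sqrtr0 mulr0 !mul0r.
by rewrite (_ : 2 - a - n%:R = 0) ?normr0 ?mul0r ?mulr0 ?mul0r// aE; ring.
Qed.

(** Needed for the real [sup] in [Kcoef] to be a genuine supremum. *)
Lemma Ifun_ub x : unit_ball x -> has_ubound [set Ifun mu a q x l | l in S].
Proof.
move=> xb; have bE := bm_dist_powR beta xb.
exists (sint (fun y => enorm (y - x) `^ beta)) => _ [l Sl <-].
rewrite (IfunE _ xb); apply: le_sint => //; first exact: bm_dist_dot.
move=> y Sy; rewrite ler_piMr ?powR_ge0//.
have <- : (1 : R) `^ q = 1 by rewrite powR1.
apply: ge0_ler_powR; rewrite ?nnegrE ?(ltW q0)//.
by rewrite (le_trans (sphere_dotv_le _ Sl))// (Sy : enorm y = 1).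
Qed.

Lemma sphere_nonempty : exists l : 'rV[R]_n, S l.
Proof. by have [e Se _] := exists_direction 0; exists e. Qed.

Lemma Kfac_ge0 x : 0 <= Kfac x.
Proof. by rewrite divr_ge0 ?powR_ge0// mulr_ge0 ?(ltW k0) ?Cna_ge0. Qed.

Lemma Ikap_ge0 x l : 0 <= Ikap x l.
Proof. by apply: sint_ge0 => y Sy; rewrite mulr_ge0 ?powR_ge0. Qed.

Lemma sint_dPker_root x l : unit_ball x ->
  (sint (fun y => `|dotv (dPker a x y) l| `^ q)) `^ q^-1 = Kfac x * Ikap x l `^ q^-1.
Proof.
move=> xb; rewrite sint_dPker// powRM ?powR_ge0 ?Ikap_ge0// -powRrM divff ?gt_eqF//.
by rewrite powRr1// Kfac_ge0.
Qed.

Lemma bm_dotv_dPker x l : unit_ball x -> bm (fun y => dotv (dPker a x y) l).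
Proof.
move=> xb; under eq_fun do rewrite dotvC.
by apply: bm_dotv_field; exact: bmv_dPker.
Qed.

Lemma KcoefE x : Kcoef mu a q x = Kfac x * (sup [set Ifun mu a q x l | l in S] + Jfun a q x) `^ q^-1.
Proof. by []. Qed.

Variable p : \bar R.
Hypothesis p1 : (1 < p)%E.
Hypothesis pq : (p = +oo%E /\ q = 1) \/ (exists p' : R, p = p'%:E /\ p'^-1 + q^-1 = 1).

Lemma Lpnorm_ge0 phi : 0 <= Lpnorm mu p phi.
Proof. by rewrite fine_ge0// Lnorm_ge0. Qed.

Lemma grad_le phi x : in_Lp mu p phi -> unit_ball x ->
  enorm (grad (Pint mu a phi) x) <= Kcoef mu a q x * Lpnorm mu p phi.
Proof.
move=> iphi xb; set g := grad _ _.
(* Along its own direction the gradient has its full length, so a bound uniform in [l] suffices. *)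
have [l Sl gE] := exists_direction g.
have -> : enorm g = dotv g l.
  by rewrite {2}gE dotvZl (sphere_dotv Sl) mulr1.
have ii := Lp_integrable Hmu p1 q1 pq iphi.
rewrite (@dotv_grad_Pint _ _ _ Hmu a x l phi xb iphi.1 ii).
apply: (le_trans (ler_norm _)).
apply: (le_trans (hoelder_sint Hmu p1 q1 pq (bm_dotv_dPker l xb) iphi)).
rewrite ler_wpM2r ?Lpnorm_ge0// sint_dPker_root// KcoefE ler_wpM2l ?Kfac_ge0//.
have le1 : Ikap x l <= sup [set Ifun mu a q x l | l in S] + Jfun a q x.
  rewrite (le_trans (Ikap_le xb Sl))// lerD2r; apply: ub_le_sup; first exact: Ifun_ub.
  by exists l.
apply: ge0_ler_powR; rewrite ?nnegrE ?invr_ge0 ?(ltW q0) ?Ikap_ge0//.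
exact: le_trans (Ikap_ge0 x l) le1.
Qed.

(** Testing with the extremal density of each direction [l] gives [V <= M V^(1 - 1/q)], so
    [V^(1/q) <= M]; then the supremum over [l] is taken. *)
Lemma Kcoef_optimal x M : unit_ball x -> x = 0 \/ a = 2 - n%:R ->
  (forall phi, in_Lp mu p phi -> enorm (grad (Pint mu a phi) x) <= M * Lpnorm mu p phi) ->
  Kcoef mu a q x <= M.
Proof.
move=> xb xa H.
(* Obtained from the density 1, whose norm is positive; it is needed to multiply the upper bound for
   the extremal norm by [M]. *)
have M0 : 0 <= M.
  have i1 : in_Lp mu p (fun=> 1).
    by apply: (bm_in_Lp Hmu p1 pq) => [|_ y]; [exact: bm_cst|rewrite normr1].
  have n1 : 0 < Lpnorm mu p (fun=> 1).
    have := hoelder_sint Hmu p1 q1 pq (bm_cst 1) i1.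
    rewrite (_ : (fun y : T => 1 * 1) = fun=> 1); last by apply/funext => y; rewrite mulr1.
    rewrite (_ : (fun y : T => `|1| `^ q) = fun=> 1); last first.
      by apply/funext => y; rewrite normr1 powR1.
    by rewrite (sint_cst Hmu) normr1 powR1 mul1r; exact: lt_le_trans.
  have := le_trans (enorm_ge0 _) (H _ i1).
  by rewrite pmulr_lge0.
have key l : S l -> Kfac x * Ifun mu a q x l `^ q^-1 <= M.
  move=> Sl; rewrite -Ikap_eq// -sint_dPker_root//.
  have bh := bm_dotv_dPker l xb.
  have [phi [iphi E N]] := hoelder_extremal Hmu p1 q1 pq bh.
  move: E N; set V := sint (fun y => _ `^ _) => E N.
  have V0 : 0 <= V by apply: sint_ge0 => y _; exact: powR_ge0.
  have ii := Lp_integrable Hmu p1 q1 pq iphi.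
  have VM : V <= M * V `^ (1 - q^-1).
    rewrite -{1}E -(@dotv_grad_Pint _ _ _ Hmu a x l phi xb iphi.1 ii).
    apply: (@le_trans _ _ (M * Lpnorm mu p phi)); last by rewrite ler_wpM2l.
    apply: le_trans (H _ iphi).
    by rewrite (le_trans (ler_norm _))// sphere_dotv_le.
  have [->|Vn0] := eqVneq V 0; first by rewrite powR0// invr_neq0// gt_eqF.
  have {}V0 : 0 < V by rewrite lt_neqAle eq_sym Vn0.
  rewrite -(ler_pM2r (powR_gt0 (1 - q^-1) V0)) -powRD ?Vn0 ?implybT//.
  by rewrite addrC subrK powRr1 ?(ltW V0).
rewrite KcoefE Jfun_eq0// addr0.
(* [Cna_ge0] gives only a nonnegative constant, so the zero case is settled before dividing. *)
have [->|Kn0] := eqVneq (Kfac x) 0; first by rewrite mul0r.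
have K0 : 0 < Kfac x by rewrite lt_neqAle eq_sym Kn0 Kfac_ge0.
have I0 l : 0 <= Ifun mu a q x l by rewrite -Ikap_eq// Ikap_ge0.
(* The supremum stands inside the power [1 / q], so the bounds for the single directions are raised
   to the power [q] first. *)
have sup_le : sup [set Ifun mu a q x l | l in S] <= (M / Kfac x) `^ q.
  apply: ge_sup.
    by have [l Sl] := sphere_nonempty; exists (Ifun mu a q x l); exists l.
  move=> _ [l Sl <-].
  have := key l Sl; rewrite mulrC -ler_pdivlMr// => h.
  have := @ge0_ler_powR _ q (ltW q0) _ _ _ _ h.
  rewrite !nnegrE powR_ge0 divr_ge0 ?(ltW K0)// => /(_ isT isT).
  by rewrite -powRrM mulVf ?gt_eqF// powRr1.
have sup0 : 0 <= sup [set Ifun mu a q x l | l in S].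
  have [l Sl] := sphere_nonempty; apply: le_trans (I0 l) _.
  by apply: ub_le_sup; [exact: Ifun_ub|exists l].
rewrite mulrC -ler_pdivlMr//.
have -> : M / Kfac x = ((M / Kfac x) `^ q) `^ q^-1.
  by rewrite -powRrM divff ?gt_eqF// powRr1// divr_ge0 ?(ltW K0).
by apply: ge0_ler_powR; rewrite ?nnegrE ?invr_ge0 ?powR_ge0 ?(ltW q0).
Qed.

End optimal_constant.

Theorem theorem1p1 (R : realType) (n : nat) (mu : {measure set borelRn R n -> \bar R})
    (a : R) (p : \bar R) (q : R) :
  (3 <= n)%N ->
  is_normalized_sphere_measure mu ->
  a < 1 ->
  (1 < p)%E ->
  1 <= q ->
  ((p = +oo%E /\ q = 1) \/ (exists p' : R, p = p'%:E /\ p'^-1 + q^-1 = 1)) ->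
  (forall phi : borelRn R n -> R, in_Lp mu p phi ->
     forall x : 'rV[R]_n, unit_ball x ->
       enorm (grad (Pint mu a phi) x) <= Kcoef mu a q x * Lpnorm mu p phi)
  /\
  (forall x : 'rV[R]_n, unit_ball x -> (x = 0 \/ a = 2 - n%:R) ->
     forall C : R,
       (forall phi : borelRn R n -> R, in_Lp mu p phi ->
          enorm (grad (Pint mu a phi) x) <= C * Lpnorm mu p phi) ->
       Kcoef mu a q x <= C).
Proof.
move=> n3 Hmu a1 p1 q1 pq; split.
  by move=> phi iphi x xb; exact: grad_le.
by move=> x xb xa M HM; exact: (Kcoef_optimal Hmu n3 a1 q1 p1 pq xb xa HM).
Qed.
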